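(* There is a constant $C>0$ depending only on $V$ such that for all $k_F\ge1$ (with $N=|B_F|$), all $\kappa>0$, and every normalized eigenvector $\Psi\in D(H'_{\mathrm{kin}})$ of $H_N$ with $\langle\Psi,H_N\Psi\rangle\le E_{\mathrm{FS}}+\kappa k_F$, $$\big\langle\Psi,\big(H'_{\mathrm{kin}}+k_F^{-1}\mathcal N_EH'_{\mathrm{kin}}\big)\Psi\big\rangle\le C(\kappa+1)^2k_F.$$
   Context: Let $\mathbb T^3=[0,2\pi]^3$ with periodic boundary conditions and $V:\mathbb T^3\to\mathbb R$ a potential with Fourier coefficients $\hat V_k=\int_{\mathbb T^3}V(x)e^{-ik\cdot x}dx$ ($k\in\mathbb Z^3$) satisfying $\hat V_k\ge0$, $\hat V_{-k}=\hat V_k$ and $\sum_{k\in\mathbb Z^3}\hat V_k|k|<\infty$. For $k_F>0$ let $B_F=\overline B(0,k_F)\cap\mathbb Z^3$, $B_F^c=\mathbb Z^3\setminus B_F$, $N=|B_F|$. Let $\mathcal H_N=\bigwedge^N L^2(\mathbb T^3)$ and $H_N=\sum_{i=1}^N(-\Delta_i)+k_F^{-1}\sum_{1\le i<j\le N}V(x_i-x_j)$ with domain $\bigwedge^N H^2(\mathbb T^3)$. Let $u_p(x)=(2\pi)^{-3/2}e^{ip\cdot x}$ and $c_p,c_p^*$ the fermionic annihilation/creation operators of $u_p$. Let $\psi_{\mathrm{FS}}=\bigwedge_{p\in B_F}u_p$ and $E_{\mathrm{FS}}=\langle\psi_{\mathrm{FS}},H_N\psi_{\mathrm{FS}}\rangle$.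 On $\mathcal H_N$ let $H'_{\mathrm{kin}}=\sum_{p\in B_F^c}|p|^2c_p^*c_p-\sum_{p\in B_F}|p|^2c_pc_p^*$ (equal to $\sum_i(-\Delta_i)-\sum_{p\in B_F}|p|^2\ge0$) and $\mathcal N_E=\sum_{p\in B_F^c}c_p^*c_p$; these commute, so $\mathcal N_EH'_{\mathrm{kin}}\ge0$. *)

(* Defs.v *)
From HB Require Import structures.
From mathcomp Require Import all_boot all_order all_algebra all_fingroup.
From mathcomp Require Import all_classical all_reals all_analysis.
From mathcomp Require Import complex.
Set Implicit Arguments. Unset Strict Implicit. Unset Printing Implicit Defensive.
Import Order.TTheory GRing.Theory Num.Theory.
Local Open Scope classical_set_scope.
Local Open Scope ring_scope.

Definition Z3 := (int * int * int)%type.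
Definition addZ3 (p q : Z3) : Z3 := (p.1.1 + q.1.1, p.1.2 + q.1.2, p.2 + q.2).
Definition oppZ3 (p : Z3) : Z3 := (- p.1.1, - p.1.2, - p.2).
Definition sqnZ3 (p : Z3) : int := p.1.1 ^+ 2 + p.1.2 ^+ 2 + p.2 ^+ 2.

Section Defs.
Variable R : realType.
Local Notation C := (R[i]).

Definition toC (r : R) : C := Complex r 0.
Definition normZ3 (k : Z3) : R := Num.sqrt (sqnZ3 k)%:~R.
Definition cabs (z : C) : R := Num.sqrt (complex.Re z ^+ 2 + complex.Im z ^+ 2).

Definition rsum (T : choiceType) (f : T -> R) : R :=
  fine (\esum_(x in [set: T]) (Num.max (f x) 0)%:E)
  - fine (\esum_(x in [set: T]) (Num.max (- f x) 0)%:E).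
Definition csum (T : choiceType) (f : T -> C) : C :=
  Complex (rsum (fun x => complex.Re (f x))) (rsum (fun x => complex.Im (f x))).

(* Fermi ball B_F = closed ball of radius kF in Z^3, as a duplicate-free list *)
Definition coordRange (K : nat) : seq int := [seq (i%:Z - K%:Z) | i <- iota 0 (K.*2.+1)].
Definition BF (kF : R) : seq Z3 :=
  let K := `|Num.floor kF|%N in
  [seq p <- [seq (ab, c) | ab <- [seq (a, b) | a <- coordRange K, b <- coordRange K], c <- coordRange K]
     | (sqnZ3 p)%:~R <= kF ^+ 2].
Definition Npart (kF : R) : nat := size (BF kF).

(* N-particle momentum configurations; the antisymmetric N-particle space
   /\^N L^2(T^3) is identified (unitarily, via the basis u_p) with
   antisymmetric square-summable functions of N momenta. *)
Definition Tup (N : nat) := {ffun 'I_N -> Z3}.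
Definition wf (N : nat) := Tup N -> C.

Definition antisym N (psi : wf N) : Prop :=
  forall (s : 'S_N) (p : Tup N), psi [ffun i => p (s i)] = (-1) ^+ s * psi p.

Definition sq_summable N (psi : wf N) : Prop :=
  summable [set: Tup N] (fun p => (cabs (psi p) ^+ 2)%:E).
Definition norm2 N (psi : wf N) : R := rsum (fun p : Tup N => cabs (psi p) ^+ 2).
Definition inner N (phi psi : wf N) : C := csum (fun p : Tup N => conjc (phi p) * psi p).

(* kinetic energy sum_i |p_i|^2 (multiplication operator in momentum space) *)
Definition kin N (p : Tup N) : R := \sum_(i < N) (sqnZ3 (p i))%:~R.
(* domain of the kinetic operator (= domain of H'_kin) *)
Definition in_dom_kin N (psi : wf N) : Prop :=
  summable [set: Tup N] (fun p => ((kin p) ^+ 2 * cabs (psi p) ^+ 2)%:E).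

Definition shift2 N (p : Tup N) (i j : 'I_N) (k : Z3) : Tup N :=
  [ffun l => if l == i then addZ3 (p i) (oppZ3 k)
             else if l == j then addZ3 (p j) k else p l].

(* Multiplication by V(x_i - x_j), with V(x) = (2pi)^-3 sum_k Vhat_k e^{ik.x},
   in momentum space *)
Definition Vpair (Vhat : Z3 -> R) N (psi : wf N) (i j : 'I_N) (p : Tup N) : C :=
  toC ((2 * pi) ^- 3) * csum (fun k : Z3 => toC (Vhat k) * psi (shift2 p i j k)).

(* H_N = sum_i (-Delta_i) + kF^-1 sum_{i<j} V(x_i - x_j) in momentum space *)
Definition HN (Vhat : Z3 -> R) (kF : R) N (psi : wf N) (p : Tup N) : C :=
  toC (kin p) * psi p
  + toC kF^-1 * \sum_(i < N) \sum_(j < N | (i < j)%N) Vpair Vhat psi i j p.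

(* Fermi sea psi_FS = u_{e_0} /\ ... /\ u_{e_{N-1}} (e an enumeration of B_F),
   i.e. (N!)^{-1/2} sum_sigma sgn(sigma) prod_j [p_j = e_{sigma j}] *)
Definition psiFS (kF : R) : wf (Npart kF) := fun p =>
  toC (Num.sqrt ((Npart kF)`!)%:R)^-1 *
  \sum_(s : 'S_(Npart kF))
     (-1) ^+ s * (\prod_(j < Npart kF) (p j == nth ((0%:Z, 0%:Z, 0%:Z) : Z3) (BF kF) (s j)))%:R.

Arguments psiFS kF _ : clear implicits.

Definition EFS (Vhat : Z3 -> R) (kF : R) : R :=
  complex.Re (inner (psiFS kF) (HN Vhat kF (psiFS kF))).

(* H'_kin = sum_i (-Delta_i) - sum_{p in B_F} |p|^2 and N_E (number of particles
   outside B_F), both diagonal in momentum space *)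
Definition Hkin' (kF : R) N (p : Tup N) : R :=
  kin p - \sum_(q <- BF kF) (sqnZ3 q)%:~R.
Definition NE (kF : R) N (p : Tup N) : R :=
  (#|[set i : 'I_N | p i \notin BF kF]|)%:R.

End Defs.

(* Main.v *)
Require Import Defs.
From HB Require Import structures.
From mathcomp Require Import all_boot all_order all_algebra all_fingroup.
From mathcomp Require Import all_classical all_reals all_analysis.
From mathcomp Require Import complex ring lra zify.
Import Order.TTheory GRing.Theory Num.Theory.
Local Open Scope classical_set_scope.
Local Open Scope ring_scope.

(** Split an eigenvector into real and imaginary parts, so that only real
functions of N momenta occur.  With [dens k] the density operator
rho_k = sum_i (shift the i-th momentum by k), the pair interaction is
sum_k V_k (rho_k^* rho_k - N) up to a positive factor of order kF^-1.  Since
V_k >= 0 and |rho_k psi_FS|^2 is at most the number O(|k| kF^2) of points of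
the Fermi ball that k moves out of it, comparing with the Fermi sea bounds
both <H'_kin> and kF^-1 sum_(k != 0) V_k |rho_k Psi|^2 by O((kappa + 1) kF).

Pairing the eigenvalue equation with N_E Psi gives <N_E H'_kin> up to
kF^-1 sum_k V_k Re <rho_k N_E Psi, rho_k Psi>, and
Re <rho N_E Psi, rho Psi> >= Re <[rho, N_E] Psi, rho Psi> because N_E >= 0.
The term |rho_k Psi|^2 is already controlled, and by the Pauli principle
|[rho_k, N_E] Psi|^2 is at most O(|k| kF^2) <N_E + 1>, where N_E <= H'_kin. *)

Set Implicit Arguments.
Unset Strict Implicit.
Unset Printing Implicit Defensive.

(** The mode k = 0 is not small: rho_0 is multiplication by N. It contributes N^2 for every
    normalized state, so it cancels exactly against the Fermi sea and is taken out before any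
    estimate. Testing with N_E Psi uses that Psi is an eigenvector: the result is the eigenvalue
    times n = <N_E>. Subtracting n E_FS then leaves at most kappa kF n, because n >= 0. This term
    and the commutator term are both O((kappa + 1) kF (n + 1)), while n itself is O((kappa + 1) kF);
    after division by kF, the product of the two bounds is the source of (kappa + 1)^2. A lune has
    O(|k| kF^2) points, against kF^3 for the ball; this surface count is what makes kF^-1 |rho_k
    psi_FS|^2 of order kF. [rsum] gives a finite but meaningless value to a divergent sum, so
    linearity and exchange of sums always come with a proof of summability. *)

Notation rsummable f := (summable [set: _] (fun x => (f x)%:E)).

(** * Absolutely convergent real sums: linearity, reindexing, Fubini *)

Section Rsum.
Context {R : realType}.
Implicit Types T K : choiceType.

Lemma rsummable_le T (f g : T -> R) :
  (forall x, `|f x| <= g x) -> rsummable g -> rsummable f.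
Proof.
move=> fg; apply: le_lt_trans; apply: le_esum => x _ /=.
by rewrite lee_fin (le_trans (fg x))// ler_norm.
Qed.

Lemma rsummable_eq T (f g : T -> R) : f =1 g -> rsummable g -> rsummable f.
Proof. by move=> fg; have -> : f = g by exact/funext. Qed.

Lemma eq_rsum T (f g : T -> R) : f =1 g -> rsum f = rsum g.
Proof. by move=> fg; have -> : f = g by exact/funext. Qed.

Lemma rsum_ge0E T (f : T -> R) : (forall x, 0 <= f x) ->
  rsum f = fine (\esum_(x in [set: T]) (f x)%:E).
Proof.
move=> f0; rewrite /rsum [X in _ - fine X]esum1 ?subr0; last first.
  by move=> x _; rewrite max_r// oppr_le0.
by congr fine; apply: eq_esum => x _; rewrite max_l.
Qed.

Lemma rsummable_esum_fin T (f : T -> R) : (forall x, 0 <= f x) -> rsummable f ->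
  \esum_(x in [set: T]) (f x)%:E \is a fin_num.
Proof.
move=> f0; rewrite summableE; congr (_ \is a fin_num).
by apply: eq_esum => x _ /=; rewrite ger0_norm.
Qed.

Lemma esum_rsum T (f : T -> R) : (forall x, 0 <= f x) -> rsummable f ->
  \esum_(x in [set: T]) (f x)%:E = (rsum f)%:E.
Proof. by move=> f0 sf; rewrite rsum_ge0E// fineK// rsummable_esum_fin. Qed.

Lemma rsummableD T (f g : T -> R) : rsummable f -> rsummable g ->
  rsummable (fun x => f x + g x).
Proof. exact: summableD. Qed.

Lemma rsummableN T (f : T -> R) : rsummable f -> rsummable (fun x => - f x).
Proof. by apply: le_lt_trans; apply: le_esum => x _ /=; rewrite normrN. Qed.

Lemma rsummableB T (f g : T -> R) : rsummable f -> rsummable g ->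
  rsummable (fun x => f x - g x).
Proof. by move=> sf sg; apply: rsummableD sf (rsummableN sg). Qed.

Lemma rsummable_norm T (f : T -> R) : rsummable f -> rsummable (fun x => `|f x|).
Proof. by apply: le_lt_trans; apply: le_esum => x _ /=; rewrite normr_id. Qed.

(** The decomposition need not be the minimal one built into [rsum]. This freedom gives additivity:
    the sum of the positive parts of two functions is in general larger than the positive part of
    their sum. *)
Lemma rsum_posneg T (f g h : T -> R) : (forall x, 0 <= g x) ->
  (forall x, 0 <= h x) -> rsummable g -> rsummable h ->
  (forall x, f x = g x - h x) -> rsum f = rsum g - rsum h.
Proof.
move=> g0 h0 sg sh fE.
have sf : rsummable f by apply: (rsummable_eq fE); exact: rsummableB.
rewrite (@rsum_ge0E _ g)// (@rsum_ge0E _ h)// /rsum.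
have pos x : `|Num.max (f x) 0| <= `|f x| by case: (leP (f x) 0); rewrite ?normr0.
have neg x : `|Num.max (- f x) 0| <= `|f x|.
  by case: (leP (- f x) 0); rewrite ?normr0 ?normrN.
have sp := rsummable_le pos (rsummable_norm sf).
have sn := rsummable_le neg (rsummable_norm sf).
rewrite -!fineB ?rsummable_esum_fin// ?le_max ?lexx ?orbT//;
  try by move=> x; rewrite le_max lexx orbT.
congr fine.
have := @esumB R T [set: T] (EFin \o g) (EFin \o h) sg sh.
move=> /(_ (fun x _ => g0 x) (fun x _ => h0 x)) <-.
congr (_ - _)%E; apply: eq_esum => x _.
  by rewrite funeposE fE EFin_max.
by rewrite funenegE fE EFin_max EFinN.
Qed.

Lemma rsum_ge0 T (f : T -> R) : (forall x, 0 <= f x) -> 0 <= rsum f.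
Proof. by move=> f0; rewrite rsum_ge0E// fine_ge0// esum_ge0 => //= x _; rewrite lee_fin. Qed.

Lemma rsummable0 T : rsummable (fun _ : T => 0 : R).
Proof. by rewrite /summable esum1 ?ltry// => x _; rewrite abse0. Qed.

Lemma rsum0 T : rsum (fun _ : T => 0 : R) = 0.
Proof. by rewrite rsum_ge0E// esum1. Qed.

Let rsumD_ge0 T (f g : T -> R) : (forall x, 0 <= f x) -> (forall x, 0 <= g x) ->
  rsummable f -> rsummable g -> rsum (fun x => f x + g x) = rsum f + rsum g.
Proof.
move=> f0 g0 sf sg; rewrite !rsum_ge0E//; last by move=> x; rewrite addr_ge0.
rewrite -fineD ?rsummable_esum_fin// -esumD//.
- by move=> x _; rewrite lee_fin.
- by move=> x _; rewrite lee_fin.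
Qed.

Let pos_part T (f : T -> R) := fun x => (`|f x| + f x) / 2.
Let neg_part T (f : T -> R) := fun x => (`|f x| - f x) / 2.

Let pos_part_ge0 T (f : T -> R) x : 0 <= pos_part f x.
Proof. by rewrite /pos_part; have := lerNnormlW (lexx `|f x|); lra. Qed.

Let neg_part_ge0 T (f : T -> R) x : 0 <= neg_part f x.
Proof. by rewrite /neg_part; have := ler_norm (f x); lra. Qed.

Let pos_partE T (f : T -> R) x : f x = pos_part f x - neg_part f x.
Proof. by rewrite /pos_part /neg_part; lra. Qed.

Let s_pos T (f : T -> R) : rsummable f -> rsummable (pos_part f).
Proof.
move=> sf; apply: rsummable_le (rsummable_norm sf) => x.
rewrite ger0_norm ?pos_part_ge0// /pos_part.
by have := ler_norm (f x); lra.
Qed.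

Let s_neg T (f : T -> R) : rsummable f -> rsummable (neg_part f).
Proof.
move=> sf; apply: rsummable_le (rsummable_norm sf) => x.
rewrite ger0_norm ?neg_part_ge0// /neg_part.
by have := lerNnormlW (lexx `|f x|); lra.
Qed.

Let rsumE T (f : T -> R) : rsummable f ->
  rsum f = rsum (pos_part f) - rsum (neg_part f).
Proof.
move=> sf; apply: rsum_posneg => //; [exact: s_pos|exact: s_neg].
Qed.

Lemma rsumD T (f g : T -> R) : rsummable f -> rsummable g ->
  rsum (fun x => f x + g x) = rsum f + rsum g.
Proof.
move=> sf sg; rewrite (@rsumE _ f)// (@rsumE _ g)//.
have sfp := s_pos sf; have sfn := s_neg sf.
have sgp := s_pos sg; have sgn := s_neg sg.
rewrite (@rsum_posneg _ _ (fun x => pos_part f x + pos_part g x)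
  (fun x => neg_part f x + neg_part g x)).
- by rewrite !rsumD_ge0//; ring.
- by move=> x; rewrite addr_ge0.
- by move=> x; rewrite addr_ge0.
- exact: rsummableD.
- exact: rsummableD.
- by move=> x; rewrite {1}(pos_partE f) {1}(pos_partE g); ring.
Qed.

Lemma rsumN T (f : T -> R) : rsum (fun x => - f x) = - rsum f.
Proof.
rewrite /rsum opprB; congr (_ - _).
by congr fine; apply: eq_esum => x _; rewrite opprK.
Qed.

Lemma rsumB T (f g : T -> R) : rsummable f -> rsummable g ->
  rsum (fun x => f x - g x) = rsum f - rsum g.
Proof. by move=> sf sg; rewrite rsumD ?rsumN//; exact: rsummableN. Qed.

Lemma ler_rsum T (f g : T -> R) : rsummable f -> rsummable g ->
  (forall x, f x <= g x) -> rsum f <= rsum g.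
Proof.
move=> sf sg fg; rewrite -subr_ge0 -rsumB//.
by apply: rsum_ge0 => x; rewrite subr_ge0.
Qed.

Lemma rsummable_sum T (I : Type) (r : seq I) (P : pred I) (f : I -> T -> R) :
  (forall i, P i -> rsummable (f i)) ->
  rsummable (fun x => \sum_(i <- r | P i) f i x).
Proof.
move=> sf; elim: r => [|i r IH].
  by apply: rsummable_eq (rsummable0 T) => x; rewrite big_nil.
have [Pi|Pi] := boolP (P i); last first.
  by apply: rsummable_eq IH => x; rewrite big_cons (negbTE Pi).
apply: rsummable_eq (rsummableD (sf _ Pi) IH) => x.
by rewrite big_cons Pi.
Qed.

Lemma rsum_sum T (I : Type) (r : seq I) (P : pred I) (f : I -> T -> R) :
  (forall i, P i -> rsummable (f i)) ->
  rsum (fun x => \sum_(i <- r | P i) f i x) = \sum_(i <- r | P i) rsum (f i).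
Proof.
move=> sf; elim: r => [|i r IH].
  by rewrite big_nil -[RHS](rsum0 T); apply: eq_rsum => x; rewrite big_nil.
have [Pi|Pi] := boolP (P i); last first.
  rewrite big_cons (negbTE Pi) -IH.
  by apply: eq_rsum => x; rewrite big_cons (negbTE Pi).
rewrite big_cons Pi -IH -rsumD; [|exact: sf|exact: rsummable_sum].
by apply: eq_rsum => x; rewrite big_cons Pi.
Qed.

Lemma reindex_rsum T K (e : T -> K) (f : K -> R) : bijective e ->
  rsum f = rsum (fun x => f (e x)).
Proof.
move=> be; rewrite /rsum !(reindex_esum [set: T] [set: K] e) ?setTT_bijective//.
Qed.

Lemma reindex_rsummable T K (e : T -> K) (f : K -> R) : bijective e ->
  rsummable f -> rsummable (fun x => f (e x)).
Proof.
move=> be; rewrite /summable (reindex_esum [set: T] [set: K] e) ?setTT_bijective//.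
Qed.

Let rsummable_pair_esum T K (G : T -> K -> R) : (forall x y, 0 <= G x y) ->
  \esum_(z in [set: T * K]) (G z.1 z.2)%:E =
  \esum_(x in [set: T]) \esum_(y in [set: K]) (G x y)%:E.
Proof.
move=> G0; rewrite esum_esum//; last by move=> *; rewrite lee_fin.
by congr (esum _ _); apply/seteqP; split.
Qed.

Lemma rsummable_pair T K (F G : T -> K -> R) :
  (forall x y, `|F x y| <= G x y) -> (forall x, rsummable (G x)) ->
  rsummable (fun x => rsum (G x)) ->
  rsummable (fun z : T * K => F z.1 z.2).
Proof.
move=> FG sG ssG.
have G0 x y : 0 <= G x y by apply: le_trans (FG x y).
apply: (@rsummable_le _ _ (fun z : T * K => G z.1 z.2)) => //.
rewrite /summable (eq_esum (b := fun z => (G z.1 z.2)%:E)); last first.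
  by move=> z _ /=; rewrite ger0_norm.
rewrite rsummable_pair_esum//.
under eq_esum => x _ do rewrite esum_rsum//.
rewrite esum_rsum ?ltry// => x; exact: rsum_ge0.
Qed.

Let rsum_pair_ge0 T K (F : T -> K -> R) :
  (forall x y, 0 <= F x y) -> rsummable (fun z : T * K => F z.1 z.2) ->
  [/\ forall x, rsummable (F x), rsummable (fun x => rsum (F x)) &
      rsum (fun z : T * K => F z.1 z.2) = rsum (fun x => rsum (F x))].
Proof.
move=> F0 sF.
have E := rsummable_pair_esum F0.
have fin : \esum_(z in [set: T * K]) (F z.1 z.2)%:E \is a fin_num.
  exact: rsummable_esum_fin.
have S x : rsummable (F x).
  apply: le_lt_trans (_ : \esum_(z in [set: T * K]) (F z.1 z.2)%:E < +oo)%E;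
    last by move: fin; rewrite fin_numElt => /andP[].
  rewrite E (eq_esum (b := fun y => (F x y)%:E)); last first.
    by move=> y _ /=; rewrite ger0_norm.
  rewrite [leRHS](esumID [set x])//; last first.
    by move=> y _; apply: esum_ge0 => *; rewrite lee_fin.
  rewrite setTI esum_set1; last by apply: esum_ge0 => *; rewrite lee_fin.
  rewrite leeDl// esum_ge0// => *.
  by apply: esum_ge0 => *; rewrite lee_fin.
have EE : \esum_(z in [set: T * K]) (F z.1 z.2)%:E =
    \esum_(x in [set: T]) (rsum (F x))%:E.
  by rewrite E; apply: eq_esum => x _; rewrite esum_rsum.
split=> //.
- rewrite /summable (eq_esum (b := fun x => (rsum (F x))%:E)); last first.
    by move=> x _ /=; rewrite ger0_norm// rsum_ge0.
  by rewrite -EE; move: fin; rewrite fin_numElt => /andP[].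
- rewrite rsum_ge0E// EE -rsum_ge0E// => x; exact: rsum_ge0.
Qed.

Lemma rsum_pair T K (F : T -> K -> R) :
  rsummable (fun z : T * K => F z.1 z.2) ->
  [/\ forall x, rsummable (F x), rsummable (fun x => rsum (F x)) &
      rsum (fun z : T * K => F z.1 z.2) = rsum (fun x => rsum (F x))].
Proof.
move=> sF.
have [P1 P2 P3] := rsum_pair_ge0 (F := fun x => pos_part (F x))
  (fun x y => pos_part_ge0 _ _) (s_pos sF).
have [N1 N2 N3] := rsum_pair_ge0 (F := fun x => neg_part (F x))
  (fun x y => neg_part_ge0 _ _) (s_neg sF).
have S x : rsummable (F x).
  by apply: rsummable_eq (rsummableB (P1 x) (N1 x)) => y; rewrite -pos_partE.
have E x : rsum (F x) = rsum (pos_part (F x)) - rsum (neg_part (F x)).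
  exact: rsumE.
split=> //.
- by apply: rsummable_eq (rsummableB P2 N2).
- rewrite (rsumE sF) P3 N3 -rsumB//; apply: eq_rsum => x; by rewrite E.
Qed.

Lemma exchange_rsum T K (F : T -> K -> R) :
  rsummable (fun z : T * K => F z.1 z.2) ->
  rsum (fun x => rsum (F x)) = rsum (fun y => rsum (fun x => F x y)).
Proof.
move=> sF; have [_ _ <-] := rsum_pair sF.
have bs : bijective (fun z : K * T => (z.2, z.1)).
  by exists (fun z : T * K => (z.2, z.1)); case.
have sF' := reindex_rsummable bs sF.
have [_ _ <-] := @rsum_pair _ _ (fun y x => F x y) sF'.
by rewrite (reindex_rsum _ bs).
Qed.

Lemma rsummableZ T (a : R) (f : T -> R) : rsummable f -> rsummable (fun x => a * f x).
Proof.
move=> sf; rewrite /summable.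
(* An integer above [|a|] turns the multiple into a finite sum of copies of [|f|], for which
   summability is already known. *)
have [n na] : exists n : nat, `|a| <= n%:R.
  by exists (Num.truncn `|a|).+1; apply: ltW; exact: truncnS_gt.
apply: (@rsummable_le _ _ (fun x => \sum_(i < n) `|f x|)) => [x|].
  by rewrite sumr_const card_ord -mulr_natl normrM ler_wpM2r.
apply: rsummable_sum => i _; exact: rsummable_norm.
Qed.

Lemma rsum_indic T (a : T) : rsum (fun x => (x == a)%:R : R) = 1.
Proof.
rewrite rsum_ge0E// (esumID [set a])//.
rewrite setTI esum_set1// eqxx [X in (_ + X)%E]esum1 ?adde0//.
by move=> x [_ /= /eqP/negPf ->].
Qed.

Lemma rsummable_indic T (a : T) : rsummable (fun x => (x == a)%:R : R).
Proof.
rewrite /summable (esumID [set a])//.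
rewrite setTI esum_set1// eqxx [X in (_ + X)%E]esum1 ?adde0 ?ltry//.
by move=> x [_ /= /eqP/negPf ->]; rewrite normr0.
Qed.

Lemma rsumZ T (a : R) (f : T -> R) : rsummable f ->
  rsum (fun x => a * f x) = a * rsum f.
Proof.
suff Z0 (b : R) (g : T -> R) : 0 < b -> (forall x, 0 <= g x) ->
    rsummable g -> rsum (fun x => b * g x) = b * rsum g.
  have Zp (b : R) (g : T -> R) : 0 < b -> rsummable g ->
      rsum (fun x => b * g x) = b * rsum g.
    move=> b0 sg; rewrite (rsumE sg) mulrBr -!Z0 //; [|exact: s_neg|exact: s_pos].
    rewrite -rsumB; [|exact/rsummableZ/s_pos|exact/rsummableZ/s_neg].
    by apply: eq_rsum => x; rewrite -mulrBr -pos_partE.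
  move=> sf; have [a0|a0|->] := ltgtP a 0; [|exact: Zp|].
  - rewrite -[a]opprK mulNr -Zp ?oppr_gt0// -rsumN.
    by apply: eq_rsum => x; rewrite mulNr.
  - by rewrite mul0r -[RHS](rsum0 T); apply: eq_rsum => x; rewrite mul0r.
(* Only this inequality is read off finite partial sums; the reverse one is the same inequality for
   [b^-1] and the function [b * g]. *)
have le (d : R) (h : T -> R) : 0 < d -> (forall x, 0 <= h x) ->
    rsummable h -> rsum (fun x => d * h x) <= d * rsum h.
  move=> b0 g0 sg; rewrite -lee_fin -esum_rsum; last exact: rsummableZ.
    rewrite EFinM -esum_rsum//; apply: ge_ereal_sup => _ [X [finX _] <-].
    rewrite (eq_fsbigr (fun x => d%:E * (h x)%:E)%E) //.
    rewrite -ge0_mule_fsumr; last by move=> x; rewrite lee_fin.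
    by rewrite lee_pmul2l// ereal_sup_ubound//; exists X.
  by move=> x; rewrite mulr_ge0// ltW.
move=> b0 g0 sg; apply/eqP; rewrite eq_le le//=.
have := le b^-1 (fun x => b * g x).
rewrite invr_gt0 => /(_ b0 (fun x => mulr_ge0 (ltW b0) (g0 x)) (rsummableZ b sg)).
rewrite (eq_rsum (g := g)) => [|x]; last by rewrite mulKf ?gt_eqF.
by rewrite -(ler_pM2l b0) mulVKf ?gt_eqF.
Qed.

End Rsum.

(** * Shifting one momentum of a configuration *)

Section Tuples.
Context {N : nat}.
Implicit Types (p : Tup N) (i j : 'I_N) (k : Z3).

(** Composition with [bump k i] is multiplication by exp(- i k . x_i) seen in momentum space. *)
Definition bump k i p : Tup N := [ffun l => if l == i then p l + k else p l].

Lemma bumpE k i p l : bump k i p l = if l == i then p l + k else p l.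
Proof. by rewrite ffunE. Qed.

Lemma bumpC k l i j p : bump k i (bump l j p) = bump l j (bump k i p).
Proof.
by apply/ffunP => m; rewrite !bumpE; case: eqP => // _; case: eqP; rewrite // addrAC.
Qed.

Lemma bumpK k i : cancel (bump k i) (bump (- k) i).
Proof. by move=> p; apply/ffunP => m; rewrite !bumpE; case: eqP; rewrite ?addrK. Qed.

Lemma bumpNK k i : cancel (bump (- k) i) (bump k i).
Proof. by move=> p; apply/ffunP => m; rewrite !bumpE; case: eqP; rewrite ?subrK. Qed.

Lemma bump_bij k i : bijective (bump k i).
Proof. by exists (bump (- k) i); [exact: bumpK|exact: bumpNK]. Qed.

Lemma shift2E p i j k : i != j -> shift2 p i j k = bump (- k) i (bump k j p).
Proof.
move=> ij; apply/ffunP => l; rewrite ffunE !bumpE.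
have [->|li] := eqVneq l i; first by rewrite (negbTE ij).
by case: eqP => // ->.
Qed.

End Tuples.

(** * Density operators and the pair interaction as a quadratic form in them *)

Section Forms.
Context {R : realType} {N : nat}.
Implicit Types (u v phi : Tup N -> R) (p : Tup N).

Definition l2 u := rsummable (fun p => u p ^+ 2).
Definition ip u v := rsum (fun p => u p * v p).

Lemma l2_mul u v : l2 u -> l2 v -> rsummable (fun p => u p * v p).
Proof.
move=> su sv; apply: rsummable_le (rsummableD su sv) => p.
rewrite normrM -[u p ^+ 2]real_normK ?num_real// -[v p ^+ 2]real_normK ?num_real//.
by have := sqr_ge0 (`|u p| - `|v p|); nra.
Qed.

Lemma l2D u v : l2 u -> l2 v -> l2 (fun p => u p + v p).
Proof.
move=> su sv.
apply: rsummable_eq (rsummableD (rsummableD su sv) (rsummableZ 2 (l2_mul su sv))).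
by move=> p /=; ring.
Qed.

Lemma l2_bounded (M : R) (f : Tup N -> R) u : (forall p, `|f p| <= M) ->
  l2 u -> l2 (fun p => f p * u p).
Proof.
move=> fM su; apply: rsummable_le (rsummableZ (M ^+ 2) su) => p.
rewrite exprMn normrM (ger0_norm (sqr_ge0 (u p))) ler_wpM2r ?sqr_ge0//.
by rewrite normrX; apply: lerXn2r => //; rewrite nnegrE // (le_trans _ (fM p)).
Qed.

Lemma l2_sum (I : Type) (r : seq I) (P : pred I) (f : I -> Tup N -> R) :
  (forall i, P i -> l2 (f i)) -> l2 (fun p => \sum_(i <- r | P i) f i p).
Proof.
move=> sf; elim: r => [|i r IH].
  apply: rsummable_eq (@rsummable0 R (Tup N)) => x.
  by rewrite big_nil expr0n.
have [Pi|Pi] := boolP (P i).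
  by apply: rsummable_eq (l2D (sf _ Pi) IH) => x; rewrite big_cons Pi.
by apply: rsummable_eq IH => x; rewrite big_cons (negbTE Pi).
Qed.

Lemma l2_bump k i u : l2 u -> l2 (fun p => u (bump k i p)).
Proof. exact: (reindex_rsummable (bump_bij k i)). Qed.

Lemma l2_bump2 k l i j u : l2 u -> l2 (fun p => u (bump k i (bump l j p))).
Proof. by move=> /(l2_bump k i); exact: (@l2_bump l j (fun p => u (bump k i p))). Qed.

Definition dens k u p : R := \sum_(i < N) u (bump k i p).

Lemma l2_dens k u : l2 u -> l2 (dens k u).
Proof. by move=> su; apply: l2_sum => i _; exact: l2_bump. Qed.

Lemma dens0 u p : dens 0 u p = N%:R * u p.
Proof.
rewrite /dens (eq_bigr (fun=> u p)).
  by rewrite sumr_const card_ord mulr_natl.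
move=> i _; congr u; apply/ffunP => l; rewrite bumpE addr0; by case: eqP.
Qed.

(** The matrix element of exp(i k . (x_i - x_j)) between [phi] and [u]; at i = j the operator is the
    identity, whatever k. *)
Definition corr phi u k i j := ip phi (fun p => u (bump (- k) i (bump k j p))).

Lemma corr_norm_le phi u k i j : l2 phi -> l2 u ->
  `|corr phi u k i j| <= ip phi phi + ip u u.
Proof.
move=> sp su; pose w p := u (bump (- k) i (bump k j p)).
have sw : l2 w by exact: l2_bump2.
have -> : ip u u = ip w w.
  rewrite /ip (reindex_rsum _ (bump_bij (- k) i)).
  by rewrite (reindex_rsum _ (bump_bij k j)).
have H p : `|phi p * w p| <= phi p * phi p + w p * w p.
  rewrite normrM -!expr2 -(real_normK (num_real (phi p))).
  by rewrite -(real_normK (num_real (w p))); have := sqr_ge0 (`|phi p| - `|w p|); nra.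
have s1 := l2_mul sp sw; have s2 := rsummableD (l2_mul sp sp) (l2_mul sw sw).
rewrite -rsumD; [|exact: l2_mul..].
rewrite ler_norml /corr /ip -rsumN; apply/andP; split; apply: ler_rsum => //.
- exact: rsummableN.
- by move=> p; have := H p; rewrite ler_norml => /andP[].
- by move=> p; have := H p; rewrite ler_norml => /andP[].
Qed.

Lemma corr_sym phi u k i j : corr phi u k i j = corr phi u (- k) j i.
Proof. by apply: eq_rsum => p; rewrite opprK bumpC. Qed.

Lemma corr_diag phi u k i : corr phi u k i i = ip phi u.
Proof. by apply: eq_rsum => p; rewrite bumpK. Qed.

Lemma ip_dens phi u k : l2 phi -> l2 u ->
  ip (dens k phi) (dens k u) = \sum_(i < N) \sum_(j < N) corr phi u k i j.
Proof.
move=> sp su; rewrite /ip /dens.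
under eq_rsum => p do rewrite big_distrlr /=.
rewrite rsum_sum => [|i _]; last first.
  by apply: rsummable_sum => j _; apply: l2_mul; exact: l2_bump.
apply: eq_bigr => i _; rewrite rsum_sum => [|j _]; last first.
  by apply: l2_mul; exact: l2_bump.
apply: eq_bigr => j _.
rewrite (reindex_rsum _ (bump_bij (- k) i)) /corr.
by apply: eq_rsum => p; rewrite bumpNK bumpC.
Qed.

Lemma sum_sym (F : 'I_N -> 'I_N -> R) : (forall i j, F i j = F j i) ->
  \sum_(i < N) \sum_(j < N) F i j =
  2 * \sum_(i < N) \sum_(j < N | (i < j)%N) F i j + \sum_(i < N) F i i.
Proof.
move=> Fs.
have -> : \sum_(i < N) \sum_(j < N) F i j = \sum_(i < N)
    (\sum_(j < N | (i < j)%N) F i j + \sum_(j < N | (j < i)%N) F i j + F i i).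
  apply: eq_bigr => i _.
  rewrite (bigID (fun j : 'I_N => (i < j)%N)) /= -addrA; congr (_ + _).
  rewrite [LHS](bigD1 i) ?ltnn//= addrC; congr (_ + _); apply: eq_bigl => j.
  by rewrite -leqNgt [RHS]ltn_neqAle andbC.
rewrite !big_split /=; congr (_ + _).
rewrite mulr_natl mulr2n; congr (_ + _).
rewrite (exchange_big_dep xpredT)//=.
by apply: eq_bigr => i _; apply: eq_bigr => j _.
Qed.

Section Interaction.
Variable V : Z3 -> R.
Hypothesis V0 : forall k, 0 <= V k.
Hypothesis VN : forall k, V (- k) = V k.
Hypothesis sV : rsummable V.

Definition Vint u p : R := \sum_(i < N) \sum_(j < N | (i < j)%N)
  rsum (fun k => V k * u (shift2 p i j k)).

Lemma rsummableVM (M : R) (f : Z3 -> R) : (forall k, `|f k| <= M) ->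
  rsummable (fun k => V k * f k).
Proof.
move=> fM; apply: rsummable_le (rsummableZ M sV) => k.
by rewrite normrM ger0_norm// mulrC ler_wpM2r.
Qed.

(** A product is at most the sum of two squares, and the l2 norm of the shifted [u] does not depend
    on k because shifts are bijections. The sum over k therefore costs only the sum of V. *)
Let pairs phi u i j : i != j -> l2 phi -> l2 u ->
  rsummable (fun z : Z3 * Tup N => V z.1 * (phi z.2 * u (shift2 z.2 i j z.1))).
Proof.
move=> ij sp su.
pose w k p := u (bump (- k) i (bump k j p)).
have sw k : l2 (w k) by exact: l2_bump2.
apply: (@rsummable_pair _ _ _
  (fun k p => V k * (phi p * u (shift2 p i j k)))
  (fun k p => V k * (phi p ^+ 2 + w k p ^+ 2))).
- move=> k p; rewrite shift2E// -/(w k p) normrM ger0_norm// ler_wpM2l//.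
  rewrite normrM -(real_normK (num_real (phi p))) -(real_normK (num_real (w k p))).
  by have := sqr_ge0 (`|phi p| - `|w k p|); nra.
- by move=> k; apply: rsummableZ; apply: rsummableD => //; exact: sw.
- apply: (@rsummable_eq _ _ _ (fun k => V k *
    (rsum (fun p => phi p ^+ 2) + rsum (fun p => u p ^+ 2)))); last first.
    by apply: (@rsummableVM
      `|rsum (fun p => phi p ^+ 2) + rsum (fun p => u p ^+ 2)|).
  move=> k; rewrite rsumZ; last by apply: rsummableD => //; exact: sw.
  rewrite rsumD//; last exact: sw.
  congr (_ * (_ + _)); rewrite [RHS](reindex_rsum _ (bump_bij (- k) i)).
  by rewrite [RHS](reindex_rsum _ (bump_bij k j)).
Qed.

Let pair_form phi u i j : i != j -> l2 phi -> l2 u ->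
  rsummable (fun p => phi p * rsum (fun k => V k * u (shift2 p i j k))) /\
  rsum (fun p => phi p * rsum (fun k => V k * u (shift2 p i j k))) =
  rsum (fun k => V k * corr phi u k i j).
Proof.
move=> ij sp su.
have P1 := pairs ij sp su.
have bs : bijective (fun z : Tup N * Z3 => (z.2, z.1)).
  by exists (fun z : Z3 * Tup N => (z.2, z.1)); case.
have P2 := reindex_rsummable bs P1.
have [a1 a2 a3] := @rsum_pair _ _ _
  (fun p k => V k * (phi p * u (shift2 p i j k))) P2.
have E p : phi p * rsum (fun k => V k * u (shift2 p i j k)) =
    rsum (fun k => V k * (phi p * u (shift2 p i j k))).
  (* Fubini gives summability in k only with the factor [phi p] inside, so it is recovered by
     dividing by [phi p]; the zeros of [phi] are treated apart. *)
  have [->|phi0] := eqVneq (phi p) 0.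
    rewrite mul0r -[LHS](rsum0 Z3); apply: eq_rsum => k; by rewrite mul0r mulr0.
  rewrite -rsumZ; first by apply: eq_rsum => k; rewrite mulrCA.
  apply: rsummable_eq (rsummableZ (phi p)^-1 (a1 p)) => k.
  by rewrite mulrCA mulKf.
split; first by apply: rsummable_eq a2.
under eq_rsum => p do rewrite E.
rewrite (@exchange_rsum _ _ _ (fun p k => V k * (phi p * u (shift2 p i j k)))) //.
apply: eq_rsum => k; rewrite /corr /ip -rsumZ.
  by apply: eq_rsum => p; rewrite shift2E.
by apply: l2_mul => //; exact: l2_bump2.
Qed.

Lemma Vint_summable phi u : l2 phi -> l2 u ->
  rsummable (fun p => phi p * Vint u p).
Proof.
move=> sp su; apply: (@rsummable_eq _ _ _ (fun p => \sum_(i < N)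
    \sum_(j < N | (i < j)%N) phi p * rsum (fun k => V k * u (shift2 p i j k)))).
  by move=> p; rewrite mulr_sumr; apply: eq_bigr => i _; rewrite mulr_sumr.
apply: rsummable_sum => i _; apply: rsummable_sum => j ij.
by apply: (pair_form _ sp su).1; rewrite neq_ltn ij.
Qed.

Lemma ip_dens_le phi u k : l2 phi -> l2 u ->
  `|ip (dens k phi) (dens k u)| <= (N ^ 2)%:R * (ip phi phi + ip u u).
Proof.
move=> sp su; rewrite ip_dens//.
apply: (le_trans (ler_norm_sum _ _ _)).
have -> : (N ^ 2)%:R * (ip phi phi + ip u u) =
    \sum_(i < N) \sum_(j < N) (ip phi phi + ip u u).
  under eq_bigr do rewrite sumr_const card_ord.
  by rewrite sumr_const card_ord -mulrnA mulr_natl.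
apply: ler_sum => i _; apply: (le_trans (ler_norm_sum _ _ _)).
by apply: ler_sum => j _; exact: corr_norm_le.
Qed.

(** The sum over i < j is half of the full double sum minus its diagonal, because exchanging i and j
    replaces k by - k and V is even. The full sum is the form of the densities, and each of the N
    diagonal terms is [ip phi u]. *)
Lemma ip_Vint phi u : l2 phi -> l2 u ->
  ip phi (Vint u) = 2^-1 *
    rsum (fun k => V k * (ip (dens k phi) (dens k u) - N%:R * ip phi u)).
Proof.
move=> sp su; pose S i j := rsum (fun k => V k * corr phi u k i j).
have sS i j : rsummable (fun k => V k * corr phi u k i j).
  by apply: rsummableVM => k; exact: corr_norm_le.
have -> : ip phi (Vint u) = \sum_(i < N) \sum_(j < N | (i < j)%N) S i j.
  rewrite /ip (eq_rsum (g := fun p => \sum_(i < N)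
    \sum_(j < N | (i < j)%N) phi p * rsum (fun k => V k * u (shift2 p i j k)))).
    have ne (i j : 'I_N) : (i < j)%N -> i != j by move=> ij; rewrite neq_ltn ij.
    rewrite rsum_sum => [|i _]; last first.
      by apply: rsummable_sum => j /ne ij; exact: (pair_form ij sp su).1.
    apply: eq_bigr => i _; rewrite rsum_sum => [|j /ne ij]; last first.
      exact: (pair_form ij sp su).1.
    by apply: eq_bigr => j /ne ij; exact: (pair_form ij sp su).2.
  by move=> p; rewrite mulr_sumr; apply: eq_bigr => i _; rewrite mulr_sumr.
have SC i j : S i j = S j i.
  rewrite /S (@reindex_rsum _ _ _ -%R); last first.
    by exists -%R; exact: opprK.
  by apply: eq_rsum => k; rewrite VN corr_sym opprK.
have := sum_sym SC.
have -> : \sum_(i < N) S i i = N%:R * rsum (fun k => V k * ip phi u).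
  rewrite (eq_bigr (fun=> rsum (fun k => V k * ip phi u))).
    by rewrite sumr_const card_ord mulr_natl.
  by move=> i _; apply: eq_rsum => k; rewrite corr_diag.
move=> H; have -> : \sum_(i < N) \sum_(j < N | (i < j)%N) S i j =
    2^-1 * (\sum_(i < N) \sum_(j < N) S i j - N%:R * rsum (fun k => V k * ip phi u)).
  by rewrite H addrK mulKf ?pnatr_eq0.
congr (_ * _).
have sc : rsummable (fun k => V k * ip phi u).
  by apply: (@rsummableVM `|ip phi u|).
under [RHS]eq_rsum => k do rewrite mulrBr ip_dens// mulrCA.
rewrite rsumB; [|by apply: (@rsummableVM ((N ^ 2)%:R * (ip phi phi + ip u u)));
  move=> k; rewrite -ip_dens//; exact: ip_dens_le|exact: rsummableZ].
rewrite rsumZ//; congr (_ - _).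
under [RHS]eq_rsum => k do rewrite mulr_sumr.
rewrite rsum_sum => [|i _]; last first.
  apply: (@rsummable_eq _ _ _ (fun k => \sum_(j < N) V k * corr phi u k i j)).
    by move=> k; rewrite mulr_sumr.
  by apply: rsummable_sum => j _.
apply: eq_bigr => i _; under [RHS]eq_rsum => k do rewrite mulr_sumr.
by rewrite rsum_sum.
Qed.

End Interaction.
End Forms.

(** * Lattice points of the Fermi ball, and those pushed out by a translation *)

Section FermiBall.
Context {R : realType} {kF : R}.
Hypothesis kF_ge1 : 1 <= kF.
Local Notation BF := (BF kF).
Local Notation K := `|Num.floor kF|%N.

Lemma mem_coordRange n (a : int) : (a \in coordRange n) = (`|a| <= n%:Z).
Proof.
apply/mapP/idP => [ [i iK ->] | an].
  by move: iK; rewrite mem_iota => /andP[_ i2]; lia.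
by exists (absz (a + n%:Z)); [rewrite mem_iota|]; lia.
Qed.

Lemma uniq_coordRange n : uniq (coordRange n).
Proof. by rewrite map_inj_uniq ?iota_uniq// => i j; lia. Qed.

Lemma size_coordRange n : size (coordRange n) = n.*2.+1.
Proof. by rewrite size_map size_iota. Qed.

Lemma sqnZ3_ge0 p : 0 <= sqnZ3 p.
Proof. by rewrite !addr_ge0// sqr_ge0. Qed.

Lemma floor_kF_ge1 : 1 <= Num.floor kF.
Proof. by rewrite floor_ge_int. Qed.

Lemma coord_le_floor (a : int) : (a ^+ 2)%:~R <= kF ^+ 2 -> `|a| <= K%:Z.
Proof.
have kF0 : 0 <= kF := le_trans ler01 kF_ge1.
rewrite rmorphXn /= -(real_normK (num_real (a%:~R : R))) => a2.
have : `|a%:~R| <= kF by rewrite -(@ler_pXn2r _ 2)// nnegrE.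
rewrite -intr_norm -floor_ge_int => h.
by rewrite gez0_abs// (le_trans _ floor_kF_ge1).
Qed.

Lemma mem_BF p : (p \in BF) = ((sqnZ3 p)%:~R <= kF ^+ 2).
Proof.
rewrite mem_filter; apply: andb_idr => pk; case: p pk => [ [a b] c] pk.
have [a2 b2 c2] : [/\ (a ^+ 2)%:~R <= kF ^+ 2, (b ^+ 2)%:~R <= kF ^+ 2 &
    (c ^+ 2)%:~R <= kF ^+ 2].
  split; apply: le_trans pk; rewrite ler_int /sqnZ3 /=;
  by have := sqr_ge0 a; have := sqr_ge0 b; have := sqr_ge0 c; lia.
apply/allpairsP; exists ((a, b), c); split=> //; last first.
  by rewrite mem_coordRange coord_le_floor.
by apply/allpairsP; exists (a, b); rewrite !mem_coordRange !coord_le_floor.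
Qed.

Lemma mem_BF_floor p : (p \in BF) = (sqnZ3 p <= Num.floor (kF ^+ 2)).
Proof. by rewrite mem_BF floor_ge_int. Qed.

Lemma uniq_BF : uniq BF.
Proof.
apply: filter_uniq; apply: allpairs_uniq; rewrite ?uniq_coordRange//.
  by apply: allpairs_uniq; rewrite ?uniq_coordRange// => -[a b] [c d].
by move=> -[a b] [c d].
Qed.

Lemma memN_BF p : (- p \in BF) = (p \in BF).
Proof. by rewrite !mem_BF_floor /sqnZ3 /= !sqrrN. Qed.

Definition lune k := [seq p <- BF | p + k \notin BF].

Lemma mem_lune k p : (p \in lune k) = (p \in BF) && (p + k \notin BF).
Proof. by rewrite mem_filter andbC. Qed.

Lemma uniq_lune k : uniq (lune k).
Proof. exact: filter_uniq uniq_BF. Qed.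

(** A point leaving the ball under k + l either is already outside after the step k, or is still
    inside at p + k and leaves under l; the second kind is pulled back by k. *)
Lemma lune_sub k l : (size (lune (k + l)%R) <= size (lune k) + size (lune l))%N.
Proof.
rewrite -(size_map (fun q => q - k) (lune l)) -size_cat.
apply: uniq_leq_size (uniq_lune _) _ => p; rewrite mem_lune mem_cat => /andP[pB pkl].
rewrite mem_lune pB; case: (boolP (p + k \in BF)) => //= pk.
by apply/mapP; exists (p + k); rewrite ?addrK// mem_lune pk -addrA.
Qed.

Lemma lune_opp k : (size (lune (- k)%R) <= size (lune k))%N.
Proof.
rewrite -(size_map -%R (lune k)); apply: uniq_leq_size (uniq_lune _) _ => p.
rewrite mem_lune => /andP[pB pk]; apply/mapP; exists (- p); rewrite ?opprK//.
by rewrite mem_lune memN_BF pB -memN_BF opprD opprK.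
Qed.

Lemma lune0 : lune 0 = [::].
Proof.
by apply/eqP; rewrite -[_ == _]negbK -has_filter; apply/hasPn => p; rewrite addr0 negbK.
Qed.

Lemma lune_mulz k (a : int) : (size (lune (k *~ a)%R) <= `|a| * size (lune k))%N.
Proof.
have H (n : nat) : (size (lune (k *+ n)%R) <= n * size (lune k))%N.
  elim: n => [|n IH]; first by rewrite mulr0n lune0.
  by rewrite mulrS mulSn (leq_trans (lune_sub _ _))// leq_add2l.
case: a => n; first exact: H.
by rewrite NegzE mulrNz abszN; apply: leq_trans (lune_opp _) (H _).
Qed.

(* At most one lattice point on each coordinate line leaves a ball under a unit
   step along that line. *)
Lemma line_exit (a b s M : int) :
  a ^+ 2 + s <= M -> M < (a + 1) ^+ 2 + s ->
  b ^+ 2 + s <= M -> M < (b + 1) ^+ 2 + s -> a = b.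
Proof.
move=> h1 h2 h3 h4; case: (ltgtP a b) => // ab; exfalso; nia.
Qed.

Let square := [seq (a, b) | a <- coordRange K, b <- coordRange K].

Let lune_proj (e : Z3) (f : Z3 -> int * int) :
  (forall p, p \in BF -> f p \in square) ->
  {in lune e &, injective f} -> (size (lune e) <= (K.*2.+1) ^ 2)%N.
Proof.
move=> fB finj; rewrite -(size_map f).
have -> : (K.*2.+1 ^ 2)%N = size square by rewrite size_allpairs size_coordRange.
apply: uniq_leq_size; first by rewrite map_inj_in_uniq ?uniq_lune.
by move=> q /mapP[p]; rewrite mem_lune => /andP[pB _] ->; exact: fB.
Qed.

Let coordsBF p : p \in BF ->
  [/\ p.1.1 \in coordRange K, p.1.2 \in coordRange K & p.2 \in coordRange K].
Proof.
rewrite mem_filter => /andP[_] /allpairsP[ [x c] [+ cK ->]].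
by move=> /allpairsP[ [a b] [aK bK /= ->]].
Qed.

(** By [line_exit], forgetting the coordinate along the step is injective on the lune, and its image
    lies in a square with 2K + 1 points on each side. *)
Lemma lune_unit : [/\ (size (lune (1, 0, 0)%R) <= (K.*2.+1) ^ 2)%N,
  (size (lune (0, 1, 0)%R) <= (K.*2.+1) ^ 2)%N &
  (size (lune (0, 0, 1)%R) <= (K.*2.+1) ^ 2)%N].
Proof.
split.
- apply: (@lune_proj _ (fun p => (p.1.2, p.2))).
    by move=> p /coordsBF[_ ? ?]; apply/allpairsP; exists (p.1.2, p.2).
  move=> [ [a b] c] [ [a' b'] c']; rewrite !mem_lune !mem_BF_floor /sqnZ3 /=.
  rewrite !addr0 -!ltNge => /andP[h1 h2] /andP[h3 h4] [? ?]; subst.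
  by rewrite (@line_exit a a' (b' ^+ 2 + c' ^+ 2) (Num.floor (kF ^+ 2))) //; lra.
- apply: (@lune_proj _ (fun p => (p.1.1, p.2))).
    by move=> p /coordsBF[? _ ?]; apply/allpairsP; exists (p.1.1, p.2).
  move=> [ [a b] c] [ [a' b'] c']; rewrite !mem_lune !mem_BF_floor /sqnZ3 /=.
  rewrite !addr0 -!ltNge => /andP[h1 h2] /andP[h3 h4] [? ?]; subst.
  by rewrite (@line_exit b b' (a' ^+ 2 + c' ^+ 2) (Num.floor (kF ^+ 2))) //; lra.
- apply: (@lune_proj _ (fun p => (p.1.1, p.1.2))).
    by move=> p /coordsBF[? ? _]; apply/allpairsP; exists (p.1.1, p.1.2).
  move=> [ [a b] c] [ [a' b'] c']; rewrite !mem_lune !mem_BF_floor /sqnZ3 /=.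
  rewrite !addr0 -!ltNge => /andP[h1 h2] /andP[h3 h4] [? ?]; subst.
  by rewrite (@line_exit c c' (a' ^+ 2 + b' ^+ 2) (Num.floor (kF ^+ 2))) //; lra.
Qed.

(** Translation by k is a lattice path of unit steps along the axes, over which [lune_sub] adds up
    the bound for one step. *)
Lemma size_lune_nat k : (size (lune k) <=
  (`|k.1.1| + `|k.1.2| + `|k.2|)%N * (K.*2.+1) ^ 2)%N.
Proof.
have kE : k = (1, 0, 0) *~ k.1.1 + (0, 1, 0) *~ k.1.2 + (0, 0, 1) *~ k.2 :> Z3.
  have mulz (x y z n : int) : ((x, y, z) : Z3) *~ n =
      (x *~ n, y *~ n, z *~ n).
    have H (m : nat) : ((x, y, z) : Z3) *+ m = (x *+ m, y *+ m, z *+ m).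
      by elim: m => // m IH; rewrite !mulrS IH.
    by case: n => m; [exact: H|exact: (congr1 (-%R) (H m.+1))].
  case: k => [ [a b] c]; rewrite !mulz /= !intz !mul0rz.
  by rewrite -[RHS]/(a + 0 + 0, 0 + b + 0, 0 + 0 + c) !addr0 !add0r.
have [u1 u2 u3] := lune_unit.
have cut (e : Z3) (a : int) : (size (lune e) <= K.*2.+1 ^ 2)%N ->
    (size (lune (e *~ a)%R) <= `|a| * K.*2.+1 ^ 2)%N.
  by move=> h; rewrite (leq_trans (lune_mulz _ _))// leq_mul2l h orbT.
rewrite {1}kE !mulnDl; apply: leq_trans (lune_sub _ _) _; apply: leq_add; last exact: cut.
by apply: leq_trans (lune_sub _ _) _; apply: leq_add; exact: cut.
Qed.

(** 27 is 3 times 3^2: each of the three coordinates of k is at most |k|, and 2K + 1 <= 3 kF because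
    kF >= 1. *)
Lemma size_lune k : (size (lune k))%:R <= 27 * normZ3 R k * kF ^+ 2.
Proof.
have co (a : int) : a ^+ 2 <= sqnZ3 k -> (`|a|%N)%:R <= normZ3 R k.
  move=> h; rewrite natr_absz intr_norm -sqrtr_sqr ler_sqrt ?ler0z ?sqnZ3_ge0//.
  by rewrite -rmorphXn /= ler_int.
have c1 : (`|k.1.1|%N)%:R <= normZ3 R k.
  by apply: co; rewrite /sqnZ3 -addrA lerDl addr_ge0 ?sqr_ge0.
have c2 : (`|k.1.2|%N)%:R <= normZ3 R k.
  by apply: co; rewrite /sqnZ3 addrAC lerDr addr_ge0 ?sqr_ge0.
have c3 : (`|k.2|%N)%:R <= normZ3 R k.
  by apply: co; rewrite /sqnZ3 lerDr addr_ge0 ?sqr_ge0.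
have kK : (K%:R : R) <= kF.
  rewrite natr_absz ger0_norm; last by have := floor_kF_ge1; lia.
  exact: floor_le.
have k3 : (K.*2.+1)%:R <= 3 * kF.
  by rewrite -addn1 -muln2 natrD natrM; move: kK kF_ge1; lra.
have := size_lune_nat k; rewrite -(ler_nat R) => /le_trans; apply.
rewrite natrM !natrD natrX.
have -> : 27 * normZ3 R k * kF ^+ 2 = (3 * normZ3 R k) * (3 * kF) ^+ 2.
  by rewrite exprMn; ring.
apply: ler_pM; rewrite ?addr_ge0 ?ler0n ?exprn_ge0//.
  by move: c1 c2 c3; lra.
by apply: lerXn2r; rewrite // nnegrE ?ler0n// (le_trans _ k3).
Qed.

Lemma NE_sum N (p : Tup N) : NE kF p = \sum_(i < N) (p i \notin BF)%:R.
Proof.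
rewrite /NE -sum1_card natr_sum big_mkcond; apply: eq_bigr => i _.
by case: ifPn; [rewrite in_setE /= => ->|rewrite notin_setE /= => /negP/negbTE ->].
Qed.

Lemma NE_ge0 N (p : Tup N) : 0 <= NE kF p. Proof. exact: ler0n. Qed.

Lemma NE_le N (p : Tup N) : NE kF p <= N%:R.
Proof. by rewrite ler_nat (leq_trans (max_card _))// card_ord. Qed.

(* Particles outside the Fermi ball cost at least 1 more than the level
   [floor (kF ^+ 2)], while those inside, each counted at most once by
   injectivity, cost at least as much as the full ball. *)
Lemma NE_le_Hkin (p : Tup (Npart kF)) : injective p -> NE kF p <= Hkin' kF p.
Proof.
move=> pinj; pose m : R := (Num.floor (kF ^+ 2))%:~R.
pose g q : R := (sqnZ3 q)%:~R - m.
have -> : Hkin' kF p = \sum_i g (p i) - \sum_(q <- BF) g q.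
  rewrite /Hkin' /kin /g !big_split /= !sumrN /=.
  rewrite sumr_const card_ord big_const_seq count_predT iter_addr addr0.
  by rewrite opprD opprK addrACA addNr addr0.
have gin q : q \in BF -> g q <= 0.
  by rewrite mem_BF_floor => h; rewrite subr_le0 ler_int.
have gout q : q \notin BF -> 1 <= g q.
  by rewrite mem_BF_floor -ltNge => h; rewrite /g /m -intrB ler1z; lia.
rewrite NE_sum (bigID (fun i => p i \in BF) _ (fun i => g (p i))) /=.
have -> : \sum_(i | p i \in BF) g (p i) = \sum_(q <- BF | q \in codom p) g q.
  rewrite -[LHS](big_map p (fun q => q \in BF) g) -big_filter -[RHS]big_filter.
  apply: perm_big; apply: uniq_perm.
  - by apply: filter_uniq; rewrite map_inj_uniq ?index_enum_uniq.
  - exact: filter_uniq uniq_BF.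
  - move=> q; rewrite !mem_filter andbC; congr (_ && _).
    by apply/mapP/codomP => [ [i _ ->] | [i ->] ]; exists i.
rewrite [X in _ - X](bigID (fun q => q \in codom p)) /=.
have out : \sum_i (p i \notin BF)%:R <= \sum_(i | p i \notin BF) g (p i).
  by rewrite big_mkcond [leRHS]big_mkcond; apply: ler_sum => i _; case: ifPn => // /gout.
have inn : \sum_(q <- BF | q \notin codom p) g q <= 0.
  by rewrite big_seq_cond; apply: sumr_le0 => q /andP[/gin].
by move: out inn; lra.
Qed.

End FermiBall.

(** * The Pauli principle, and norm bounds for weighted density operators *)

Section Antisymmetric.
Context {R : realType} {N : nat}.
Implicit Types (u : Tup N -> R) (p q : Tup N) (f : Z3 -> R) (k : Z3).

Definition antisymR u := forall (s : 'S_N) p,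
  u [ffun i => p (s i)] = (-1) ^+ s * u p.

(** Transposing two equal momenta fixes the configuration but changes the sign of [u]. *)
Lemma antisymR_noninj u p : antisymR u -> ~ injective p -> u p = 0.
Proof.
move=> au pinj.
have [a [b [ab pab]]] : exists a b, a != b /\ p a = p b.
  apply: contrapT => h; apply: pinj => a b pab.
  by apply: contrapT => /eqP ab; apply: h; exists a, b.
have := au (tperm a b) p; rewrite odd_tperm ab expr1 mulN1r.
rewrite (_ : [ffun i => p (tperm a b i)] = p); first by lra.
by apply/ffunP => i; rewrite ffunE; case: tpermP => // ->.
Qed.

(** The density operator restricted to the moves that [f] selects; with the indicators [leave] and
    [enter] it yields the two halves of the commutator with N_E. *)
Definition wdens f k u p : R := \sum_(i < N) f (p i) * u (bump k i p).

Lemma wdens1 k u p : wdens (fun=> 1) k u p = dens k u p.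
Proof. by apply: eq_bigr => i _; rewrite mul1r. Qed.

Lemma antisym_wdens f k u : antisymR u -> antisymR (wdens f k u).
Proof.
move=> au s p; rewrite /wdens [in RHS](reindex_inj (@perm_inj _ s)) mulr_sumr.
apply: eq_bigr => i _; rewrite ffunE mulrCA -au; congr (_ * u _).
by apply/ffunP => l; rewrite !ffunE (inj_eq (@perm_inj _ s)).
Qed.

(** Weighted Cauchy-Schwarz through Lagrange's identity: the gap is half of the sum of w_i w_j (a_i
    - a_j)^2. *)
Lemma sum_CS (I : finType) (w a : I -> R) : (forall i, 0 <= w i) ->
  (\sum_i w i * a i) ^+ 2 <= (\sum_i w i) * \sum_i w i * a i ^+ 2.
Proof.
move=> w0; have : 0 <= \sum_i \sum_j w i * w j * (a i - a j) ^+ 2.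
  by do 2!(apply: sumr_ge0 => ? _); rewrite mulr_ge0 ?sqr_ge0// mulr_ge0.
have -> : \sum_i \sum_j w i * w j * (a i - a j) ^+ 2 =
    \sum_i \sum_j (w i * a i ^+ 2) * w j + \sum_i \sum_j w i * (w j * a j ^+ 2)
    - 2 * \sum_i \sum_j (w i * a i) * (w j * a j).
  rewrite mulr_sumr -big_split -sumrB; apply: eq_bigr => i _ /=.
  by rewrite mulr_sumr -big_split -sumrB; apply: eq_bigr => j _ /=; ring.
by rewrite -!big_distrlr /= expr2; lra.
Qed.

(** A Schur test. The first pointwise bound controls the weights seen from the target configuration
    p; undoing the shift in each term turns the weight into [f (p i - k)], and the second bound
    controls the weights seen from the source. *)
Lemma ip_wdens_le f k u (G H : Tup N -> R) :
  (forall x, 0 <= f x <= 1) -> (forall p, 0 <= G p) -> l2 u ->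
  rsummable G -> rsummable H ->
  (forall p, wdens f k u p ^+ 2 <= \sum_(i < N) f (p i) * G (bump k i p)) ->
  (forall p, (\sum_(i < N) f (p i - k)) * G p <= H p) ->
  l2 (wdens f k u) /\ rsum (fun p => wdens f k u p ^+ 2) <= rsum H.
Proof.
move=> f01 G0 su sG sH wG GH.
have s1 : l2 (wdens f k u).
  apply: l2_sum => i _; apply: (@l2_bounded _ _ 1 (fun p => f (p i))).
    by move=> p; case/andP: (f01 (p i)) => ? ?; rewrite ger0_norm.
  exact: l2_bump.
split=> //.
have sb (g : Tup N -> R) (Q : Tup N -> R) : rsummable Q -> (forall p, 0 <= Q p) ->
    (forall p, 0 <= g p <= 1) -> rsummable (fun p => g p * Q p).
  move=> sQ Q0 g01; apply: rsummable_le sQ => p; case/andP: (g01 p) => g0 g1.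
  by rewrite ger0_norm ?mulr_ge0// ler_piMl.
have s2 i : rsummable (fun p => f (p i) * G (bump k i p)).
  by apply: sb => //; exact: reindex_rsummable (bump_bij k i) sG.
have s3 i : rsummable (fun p => f (p i - k) * G p) by exact: sb.
apply: (@le_trans _ _ (rsum (fun p => \sum_(i < N) f (p i) * G (bump k i p)))).
  by apply: ler_rsum => //; exact: rsummable_sum.
rewrite rsum_sum// (eq_bigr (fun i => rsum (fun p => f (p i - k) * G p))).
  rewrite -rsum_sum//; apply: ler_rsum => //; first exact: rsummable_sum.
  by move=> p; rewrite -mulr_suml.
move=> i _; rewrite (reindex_rsum _ (bump_bij (- k) i)).
by apply: eq_rsum => p; rewrite bumpE eqxx bumpNK.
Qed.

End Antisymmetric.

(** * The commutator of a density operator with the number of excitations *)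

Section Excitations.
Context {R : realType} {kF : R} {N : nat}.
Hypothesis kF_ge1 : 1 <= kF.
Local Notation BF := (BF kF).
Local Notation lune := (@lune R kF).
Implicit Types (u : Tup N -> R) (p q : Tup N) (k : Z3).

Definition leave k (q : Z3) : R := ((q \in BF) && (q + k \notin BF))%:R.
Definition enter k (q : Z3) : R := ((q \notin BF) && (q + k \in BF))%:R.

Lemma NE_bump k i p :
  NE kF (bump k i p) = NE kF p + leave k (p i) - enter k (p i).
Proof.
rewrite !NE_sum (bigD1 i)//= [in RHS](bigD1 i)//= bumpE eqxx.
rewrite (eq_bigr (fun l => (p l \notin BF)%:R)).
  by rewrite /leave /enter; do 2!case: (_ \in BF); rewrite /=; lra.
by move=> l li; rewrite bumpE (negbTE li).
Qed.

(** The last difference is the commutator [rho_k, N_E] applied to [u]: only moves across the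
    boundary of the ball change the number of excitations. *)
Lemma dens_NE k u p : dens k (fun q => NE kF q * u q) p =
  NE kF p * dens k u p + (wdens (leave k) k u p - wdens (enter k) k u p).
Proof.
rewrite /dens /wdens mulr_sumr -sumrB -big_split; apply: eq_bigr => i _ /=.
by rewrite NE_bump; ring.
Qed.

(** The Pauli principle as a count: distinct momenta occupy each point of [s] at most once, which
    replaces the trivial bound N by the size of a lune. *)
Lemma sum_mem_le (s : seq Z3) p (g : Z3 -> Z3) : injective p -> injective g ->
  \sum_(i < N) (g (p i) \in s)%:R <= (size s)%:R :> R.
Proof.
move=> pinj ginj; rewrite -natr_sum ler_nat.
have -> : (\sum_(i < N) (g (p i) \in s) = size [seq i <- enum 'I_N | g (p i) \in s])%N.
  rewrite size_filter -sum1_count big_enum_cond [RHS]big_mkcond.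
  by apply: eq_bigr => i _ /=; case: (_ \in s).
rewrite -(size_map (g \o p)); apply: uniq_leq_size.
  rewrite map_inj_uniq; first by apply: filter_uniq; exact: enum_uniq.
  by move=> i j /ginj/pinj.
by move=> q /mapP[i + ->]; rewrite mem_filter => /andP[].
Qed.

Lemma NE_l2 u : l2 u -> l2 (fun p => NE kF p * u p).
Proof.
by apply: (@l2_bounded _ _ N%:R) => p; rewrite ger0_norm ?NE_ge0// NE_le.
Qed.

Lemma NE_summable u : l2 u -> rsummable (fun p => NE kF p * u p ^+ 2).
Proof.
move=> su; apply: rsummable_eq (l2_mul (NE_l2 su) su) => p /=.
by rewrite expr2 mulrA.
Qed.

Let enter01 k (q : Z3) : 0 <= enter k q <= 1.
Proof. by rewrite /enter ler0n lern1 leq_b1. Qed.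

Let leave01 k (q : Z3) : 0 <= leave k q <= 1.
Proof. by rewrite /leave ler0n lern1 leq_b1. Qed.

(** Cauchy-Schwarz produces the number of selected particles of p, at most the size of the lune by
    the Pauli principle. Seen from the configuration at which [u] is evaluated, a selected particle
    lies outside the ball, so the remaining weights add up to at most [NE]. *)
Lemma leave_bound k u : antisymR u -> l2 u -> l2 (wdens (leave k) k u) /\
  rsum (fun p => wdens (leave k) k u p ^+ 2) <=
  (size (lune k))%:R * rsum (fun p => NE kF p * u p ^+ 2).
Proof.
move=> au su; rewrite -rsumZ; last exact: NE_summable.
apply: (@ip_wdens_le _ _ _ _ _ (fun p => (size (lune k))%:R * u p ^+ 2)) => //.
- by move=> p; rewrite mulr_ge0// sqr_ge0.
- exact: rsummableZ.
- by apply: rsummableZ; exact: NE_summable.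
- move=> p; have [pinj|pinj] := pselect (injective p); last first.
    rewrite (antisymR_noninj (antisym_wdens _ _ au))// expr0n sumr_ge0// => i _.
    apply: mulr_ge0; first by case/andP: (leave01 k (p i)).
    by apply: mulr_ge0; [exact: ler0n|exact: sqr_ge0].
  apply: le_trans (sum_CS _ _) _; first by move=> i; case/andP: (leave01 k (p i)).
  under [leRHS]eq_bigr do rewrite mulrCA.
  rewrite -mulr_sumr ler_wpM2r//.
    by apply: sumr_ge0 => i _; rewrite mulr_ge0 ?sqr_ge0//; case/andP: (leave01 k (p i)).
  apply: le_trans (sum_mem_le (lune k) pinj (@inj_id _)).
  by apply: ler_sum => i _; rewrite /leave mem_lune.
- move=> p; rewrite mulrCA ler_wpM2l//.
  rewrite ler_wpM2r ?sqr_ge0// NE_sum; apply: ler_sum => i _.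
  by rewrite /leave subrK; case: (_ \in BF); case: (_ \in BF).
Qed.

(* Counting the entering particles of p by [NE kF p], which exceeds NE of the
   shifted configuration by 1, avoids the square of the size of the lune. *)
Lemma enter_bound k u : antisymR u -> l2 u -> l2 (wdens (enter k) k u) /\
  rsum (fun p => wdens (enter k) k u p ^+ 2) <=
  (size (lune (- k)))%:R * rsum (fun p => (NE kF p + 1) * u p ^+ 2).
Proof.
move=> au su.
have s1 : rsummable (fun p => (NE kF p + 1) * u p ^+ 2).
  by apply: rsummable_eq (rsummableD (NE_summable su) su) => p; rewrite mulrDl mul1r.
have NE1 p : 0 <= NE kF p + 1 by rewrite addr_ge0 ?NE_ge0.
rewrite -rsumZ//.
apply: (@ip_wdens_le _ _ _ _ _ (fun p => (NE kF p + 1) * u p ^+ 2)) => //.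
- by move=> p; rewrite mulr_ge0// sqr_ge0.
- exact: rsummableZ.
- move=> p; apply: le_trans (sum_CS _ _) _; first by move=> i; case/andP: (enter01 k (p i)).
  rewrite mulr_sumr; apply: ler_sum => i _; rewrite NE_bump.
  case: (boolP ((p i \notin BF) && (p i + k \in BF))) => [h|/negbTE h]; last first.
    by rewrite /enter h !mul0r mulr0.
  have -> : leave k (p i) = 0 by rewrite /leave; case/andP: h => /negbTE ->.
  have -> : enter k (p i) = 1 by rewrite /enter h.
  rewrite !mul1r addr0 subrK ler_wpM2r ?sqr_ge0// NE_sum.
  by apply: ler_sum => j _; rewrite /enter; case: (_ \in BF); case: (_ \in BF).
- move=> p; have [pinj|pinj] := pselect (injective p); last first.
    by rewrite (antisymR_noninj au)// expr0n !mulr0.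
  apply: ler_wpM2r; first by apply: mulr_ge0 => //; exact: sqr_ge0.
  apply: le_trans (sum_mem_le (lune (- k)) pinj (@inj_id _)).
  by apply: ler_sum => i _; rewrite /enter mem_lune subrK andbC.
Qed.

Lemma normZ3N k : normZ3 R (- k) = normZ3 R k.
Proof. by rewrite /normZ3 /sqnZ3 /= !sqrrN. Qed.

Lemma ip_dens_NE k u : antisymR u -> l2 u ->
  - 2 * (27 * normZ3 R k * kF ^+ 2) * rsum (fun p => (NE kF p + 1) * u p ^+ 2)
  - 2^-1 * ip (dens k u) (dens k u) <=
  ip (dens k (fun q => NE kF q * u q)) (dens k u).
Proof.
move=> au su; set L := 27 * _ * _.
have [sl bl] := leave_bound k au su; have [se be] := enter_bound k au su.
have Ll : (size (lune k))%:R <= L by exact: size_lune.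
have Le : (size (lune (- k)))%:R <= L by rewrite /L -normZ3N; exact: size_lune.
have s1 := NE_summable su.
have Q0 : 0 <= rsum (fun p => NE kF p * u p ^+ 2).
  by apply: rsum_ge0 => p; rewrite mulr_ge0 ?NE_ge0 ?sqr_ge0.
have Q1 : rsum (fun p => (NE kF p + 1) * u p ^+ 2) =
    rsum (fun p => NE kF p * u p ^+ 2) + rsum (fun p => u p ^+ 2).
  by rewrite -rsumD//; apply: eq_rsum => p; rewrite mulrDl mul1r.
have U0 : 0 <= rsum (fun p => u p ^+ 2) by apply: rsum_ge0 => p; exact: sqr_ge0.
have L0 : 0 <= L by exact: le_trans Ll.
have b1 : rsum (fun p => wdens (leave k) k u p ^+ 2) <=
    L * rsum (fun p => (NE kF p + 1) * u p ^+ 2).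
  apply: (le_trans bl); rewrite Q1 ler_pM//; lra.
have b2 : rsum (fun p => wdens (enter k) k u p ^+ 2) <=
    L * rsum (fun p => (NE kF p + 1) * u p ^+ 2).
  by apply: (le_trans be); rewrite ler_wpM2r// Q1; lra.
apply: (@le_trans _ _ (rsum (fun p => (- wdens (leave k) k u p ^+ 2
    - wdens (enter k) k u p ^+ 2) - 2^-1 * (dens k u p * dens k u p)))).
  have sd := l2_mul (l2_dens k su) (l2_dens k su).
  rewrite rsumB; [|by apply: rsummableB => //; exact: rsummableN|exact: rsummableZ].
  rewrite rsumB//; last exact: rsummableN.
  by rewrite rsumN rsumZ// /ip; move: b1 b2; lra.
apply: ler_rsum.
- apply: rsummableB; first by apply: rsummableB => //; exact: rsummableN.
  by apply: rsummableZ; apply: l2_mul; exact: l2_dens.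
- by apply: l2_mul; apply: l2_dens => //; exact: NE_l2.
- move=> p; rewrite dens_NE; set a := wdens _ _ _ _; set b := wdens _ _ _ _.
  set d := dens _ _ _; have := NE_ge0 (kF := kF) p; set n := NE kF p => n0.
  have h1 : 0 <= n * d ^+ 2 by rewrite mulr_ge0// sqr_ge0.
  (* [h2] gives (a - b) d >= - (a - b)^2 / 2 - d^2 / 2, and [h3] gives (a - b)^2 <= 2 a^2 + 2 b^2.
     Hence the 2^-1 before the density term; a^2 and b^2 cost one [L] each, hence the 2. *)
  have h2 := sqr_ge0 (a - b + d); have h3 := sqr_ge0 (a + b).
  by nra.
Qed.

End Excitations.

(** * The Fermi sea as a Slater determinant in momentum space *)

Section FermiSea.
Context {R : realType} {kF : R}.
Hypothesis kF_ge1 : 1 <= kF.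
Local Notation N := (Npart kF).
Local Notation BF := (BF kF).
Implicit Types (p : Tup N) (s t : 'S_N) (k : Z3).

Definition filling s : Tup N := [ffun j => nth ((0%:Z, 0%:Z, 0%:Z) : Z3) BF (s j)].

Definition FSR p : R :=
  (Num.sqrt (N`!)%:R)^-1 * \sum_(s : 'S_N) (-1) ^+ s * (p == filling s)%:R.

Lemma psiFSE p : @psiFS R kF p = toC (FSR p).
Proof.
rewrite /psiFS -[toC (FSR p)]/((FSR p)%:C)%C rmorphM /=; congr (_ * _).
rewrite rmorph_sum; apply: eq_bigr => s _ /=.
rewrite rmorphM rmorphXn rmorphN1 rmorph_nat; congr (_ * _%:R).
have [->|ps] := eqVneq p (filling s).
  by rewrite big1// => j _; rewrite ffunE eqxx.
have [j pj] : exists j, p j != nth ((0%:Z, 0%:Z, 0%:Z) : Z3) BF (s j).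
  apply: contrapT => h; case/eqP: ps; apply/ffunP => j; rewrite ffunE.
  by apply: contrapT => /eqP pj; apply: h; exists j.
by rewrite (bigD1 j)//= (negbTE pj) mul0n.
Qed.

Lemma filling_BF s j : filling s j \in BF.
Proof. by rewrite ffunE mem_nth// ltn_ord. Qed.

Lemma filling_surj s q : q \in BF -> exists j, filling s j = q.
Proof.
move=> qB; have iN : (index q BF < N)%N by rewrite index_mem.
exists (s^-1%g (Ordinal iN)); rewrite ffunE permKV /=.
exact: nth_index.
Qed.

Lemma filling_injective : injective filling.
Proof.
move=> s t st; apply/permP => j; have := congr1 (fun f : Tup N => f j) st.
rewrite !ffunE => /eqP; rewrite nth_uniq ?uniq_BF ?ltn_ord//.
by move/eqP/val_inj.
Qed.

Lemma FSR_neq0 p : FSR p != 0 -> exists s, p = filling s.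
Proof.
move=> p0; apply: contrapT => h; case/eqP: p0.
rewrite /FSR big1 ?mulr0// => s _; case: eqVneq => [ps|]; last by rewrite mulr0.
by case: h; exists s.
Qed.

Lemma antisym_FSR : antisymR FSR.
Proof.
move=> t p; rewrite /FSR mulrCA; congr (_ * _).
rewrite [LHS](reindex_inj (mulgI t)) mulr_sumr; apply: eq_bigr => s _.
rewrite odd_permM signr_addb mulrA; congr (_ * _%:R); congr nat_of_bool.
apply/eqP/eqP => [/ffunP h|->]; apply/ffunP => j.
  by have := h (t^-1%g j); rewrite !ffunE permM permKV.
by rewrite !ffunE permM.
Qed.

(** The configurations [filling s] are pairwise distinct, so at most one term of the determinant is
    nonzero at p and squaring creates no cross terms. *)
Lemma FSR_sqr p : FSR p ^+ 2 = (N`!)%:R^-1 * \sum_(s : 'S_N) (p == filling s)%:R.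
Proof.
rewrite /FSR exprMn exprVn sqr_sqrtr ?ler0n//; congr (_ * _).
have [[s ps]|h] := pselect (exists s, p = filling s); last first.
  rewrite !big1 ?expr0n// => s _; case: eqVneq => [ps|]; rewrite ?mulr0//;
  by case: h; exists s.
rewrite (bigD1 s)//= [RHS](bigD1 s)//= !big1 ?addr0 => [|t ts|t ts].
- by rewrite ps eqxx mulr1 sqrr_sign.
- by rewrite ps (inj_eq filling_injective) eq_sym (negbTE ts) ?mulr0.
- by rewrite ps (inj_eq filling_injective) eq_sym (negbTE ts) ?mulr0.
Qed.

Lemma l2_FSR : l2 FSR.
Proof.
apply: rsummable_eq FSR_sqr _; apply: rsummableZ; apply: rsummable_sum => s _.
exact: rsummable_indic.
Qed.

Lemma rsum_FSR : rsum (fun p => FSR p ^+ 2) = 1.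
Proof.
have si s : rsummable (fun p => (p == filling s)%:R : R) by exact: rsummable_indic.
rewrite (eq_rsum FSR_sqr) rsumZ; last exact: rsummable_sum.
rewrite rsum_sum// (eq_bigr (fun=> 1)); last by move=> s _; exact: rsum_indic.
by rewrite sumr_const card_Sn mulVf// pnatr_eq0 -lt0n fact_gt0.
Qed.

Lemma kin_FSR p : kin R p * FSR p ^+ 2 = (\sum_(q <- BF) (sqnZ3 q)%:~R) * FSR p ^+ 2.
Proof.
have [->|/FSR_neq0[s ->]] := eqVneq (FSR p) 0; first by rewrite expr0n !mulr0.
congr (_ * _); rewrite /kin (big_nth (0 : Z3)) big_mkord.
rewrite [RHS](reindex_inj (@perm_inj _ s)).
by apply: eq_bigr => j _; rewrite ffunE.
Qed.

Lemma NE_FSR p : NE kF p * FSR p ^+ 2 = 0.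
Proof.
have [->|/FSR_neq0[s ->]] := eqVneq (FSR p) 0; first by rewrite expr0n !mulr0.
by rewrite NE_sum big1 ?mul0r// => j _; rewrite filling_BF.
Qed.

(* On an injective configuration, moving a particle into a full Fermi ball is
   only possible when that particle came from outside. *)
Lemma dens_FSR k p : k != 0 -> dens k FSR p = wdens (@enter R kF k) k FSR p.
Proof.
move=> k0; have [pinj|pinj] := pselect (injective p); last first.
  rewrite -wdens1 !(antisymR_noninj (antisym_wdens _ _ antisym_FSR))//.
apply: eq_bigr => i _; have [->|] := eqVneq (FSR (bump k i p)) 0.
  by rewrite mulr0.
move=> /FSR_neq0[s bs]; rewrite /enter.
have pkB : p i + k \in BF.
  by have := filling_BF s i; rewrite -bs bumpE eqxx.
case: (boolP (p i \in BF)) => [piB|]; last by rewrite pkB mul1r.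
exfalso; have [j] := filling_surj s piB; rewrite -bs bumpE.
case: eqP => [->|ji pji]; last by case: ji; exact: pinj.
by move/eqP; rewrite -subr_eq0 addrAC subrr add0r (negbTE k0).
Qed.

(** Since [NE] vanishes on the Fermi sea, only the + 1 in [enter_bound] survives, leaving the size
    of the lune of - k. *)
Lemma ip_dens_FSR k : k != 0 ->
  ip (dens k FSR) (dens k FSR) <= 27 * normZ3 R k * kF ^+ 2.
Proof.
move=> k0; have [se be] := @enter_bound R kF _ k _ antisym_FSR l2_FSR.
have -> : ip (dens k FSR) (dens k FSR) =
    rsum (fun p => wdens (@enter R kF k) k FSR p ^+ 2).
  by apply: eq_rsum => p; rewrite dens_FSR// expr2.
apply: (le_trans be); rewrite (eq_rsum (g := fun p => FSR p ^+ 2)); last first.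
  by move=> p; rewrite mulrDl NE_FSR add0r mul1r.
by rewrite rsum_FSR mulr1 -normZ3N; exact: size_lune.
Qed.

End FermiSea.

(** * The Hamiltonian on real functions, and its quadratic form *)

Section Energy.
Context {R : realType}.
Variable V : Z3 -> R.
Hypothesis V0 : forall k, 0 <= V k.
Hypothesis VN : forall k, V (- k) = V k.
Hypothesis sVn : rsummable (fun k => V k * normZ3 R k).

Lemma normZ30 : normZ3 R 0 = 0.
Proof. by rewrite /normZ3 /sqnZ3 /= expr0n /= !addr0 sqrtr0. Qed.

Lemma normZ3_ge0 k : 0 <= normZ3 R k. Proof. exact: sqrtr_ge0. Qed.

Lemma normZ3_ge1 k : k != 0 -> 1 <= normZ3 R k.
Proof.
move=> k0; rewrite -[leLHS]sqrtr1 ler_sqrt ?ler0z ?sqnZ3_ge0// ler1z.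
have -> : 1 <= sqnZ3 k = (0 < sqnZ3 k) by lia.
rewrite lt_def sqnZ3_ge0 andbT; apply: contra k0.
case: k => [ [a b] c]; rewrite /sqnZ3 /= paddr_eq0 ?addr_ge0 ?sqr_ge0//.
rewrite paddr_eq0 ?sqr_ge0// !sqrf_eq0 => /andP[/andP[/eqP -> /eqP ->] /eqP ->].
by [].
Qed.

(** The weight |k| vanishes at 0 and is at least 1 elsewhere, so V is dominated once an indicator
    carrying [V 0] is added. *)
Lemma rsummable_V : rsummable V.
Proof.
have s0 := rsummableZ (V 0) (@rsummable_indic R _ (0 : Z3)).
apply: rsummable_le (rsummableD sVn s0) => k; rewrite ger0_norm//.
have [->|k0] := eqVneq k 0; first by rewrite normZ30 mulr0 add0r mulr1.
by rewrite mulr0 addr0 ler_peMr// normZ3_ge1.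
Qed.

Let sV := rsummable_V.

Section FixedN.
Variables (kF : R) (N : nat).
Implicit Types (u v phi : Tup N -> R) (psi : wf R N).

(** Since the Fourier coefficients of V are real, H_N has real coefficients in momentum space and
    acts separately on the real and imaginary parts of a wave function. *)
Definition HR u (p : Tup N) : R :=
  kin R p * u p + kF^-1 * ((2 * pi) ^- 3 * Vint V u p).

Lemma Re_toCM (a : R) (z : R[i]) : complex.Re (toC a * z) = a * complex.Re z.
Proof. by case: z => x y /=; rewrite mul0r subr0. Qed.

Lemma Im_toCM (a : R) (z : R[i]) : complex.Im (toC a * z) = a * complex.Im z.
Proof. by case: z => x y /=; rewrite mul0r addr0. Qed.

Lemma Re_sum (I : Type) (r : seq I) (P : pred I) (F : I -> R[i]) :
  complex.Re (\sum_(i <- r | P i) F i) = \sum_(i <- r | P i) complex.Re (F i).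
Proof. by apply: big_morph => // -[a b] [c d]. Qed.

Lemma Im_sum (I : Type) (r : seq I) (P : pred I) (F : I -> R[i]) :
  complex.Im (\sum_(i <- r | P i) F i) = \sum_(i <- r | P i) complex.Im (F i).
Proof. by apply: big_morph => // -[a b] [c d]. Qed.

Lemma Re_HN psi p : complex.Re (HN V kF psi p) = HR (fun q => complex.Re (psi q)) p.
Proof.
rewrite /HN /HR raddfD /= !Re_toCM Re_sum; congr (_ + _ * _).
rewrite /Vint mulr_sumr; apply: eq_bigr => i _; rewrite Re_sum mulr_sumr.
apply: eq_bigr => j _; rewrite /Vpair Re_toCM /csum /=; congr (_ * _).
by apply: eq_rsum => k; rewrite Re_toCM.
Qed.

Lemma Im_HN psi p : complex.Im (HN V kF psi p) = HR (fun q => complex.Im (psi q)) p.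
Proof.
rewrite /HN /HR raddfD /= !Im_toCM Im_sum; congr (_ + _ * _).
rewrite /Vint mulr_sumr; apply: eq_bigr => i _; rewrite Im_sum mulr_sumr.
apply: eq_bigr => j _; rewrite /Vpair Im_toCM /csum /=; congr (_ * _).
by apply: eq_rsum => k; rewrite Im_toCM.
Qed.

Lemma Re_inner (phi psi : wf R N) : complex.Re (inner phi psi) =
  rsum (fun p => complex.Re (phi p) * complex.Re (psi p) +
    complex.Im (phi p) * complex.Im (psi p)).
Proof.
rewrite /inner /csum /=; apply: eq_rsum => p.
by move: (phi p) (psi p) => [a b] [c d] /=; rewrite mulNr opprK.
Qed.

(** The factor 2^-1 comes from replacing pairs i < j by the full double sum, as in [ip_Vint]. *)
Definition coupling : R := kF^-1 * (2 * pi) ^- 3 * 2^-1.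
Definition dform phi u := rsum (fun k => V k * ip (dens k phi) (dens k u)).

Lemma dform_summable phi u : l2 phi -> l2 u ->
  rsummable (fun k => V k * ip (dens k phi) (dens k u)).
Proof.
move=> sp su; apply: (@rsummableVM _ _ V0 sV ((N ^ 2)%:R * (ip phi phi + ip u u))).
by move=> k; exact: ip_dens_le.
Qed.

Lemma ip_HR phi u : l2 phi -> l2 u -> rsummable (fun p => kin R p * (phi p * u p)) ->
  rsummable (fun p => phi p * HR u p) /\
  ip phi (HR u) = rsum (fun p => kin R p * (phi p * u p)) +
    coupling * (dform phi u - N%:R * ip phi u * rsum V).
Proof.
move=> sp su sk.
have sI := Vint_summable V0 sV sp su.
have E p : phi p * HR u p = kin R p * (phi p * u p) +
    (kF^-1 * (2 * pi) ^- 3) * (phi p * Vint V u p) by rewrite /HR; ring.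
have sI' := rsummableZ (kF^-1 * (2 * pi) ^- 3) sI.
split; first by apply: rsummable_eq E _; exact: rsummableD.
rewrite /ip (eq_rsum E) rsumD// rsumZ// -/(ip phi (Vint V u)).
rewrite (ip_Vint V0 VN sV sp su) /coupling -!mulrA.
congr (_ + _ * (_ * (_ * _))).
rewrite (eq_rsum (g := fun k => V k * ip (dens k phi) (dens k u) -
  (N%:R * ip phi u) * V k)) => [|k]; last by rewrite mulrBr [X in _ - X]mulrC.
rewrite rsumB; [|exact: dform_summable|exact: rsummableZ].
by rewrite rsumZ// mulrA.
Qed.

End FixedN.
End Energy.

(** * Energy comparison for an eigenvector with real part u and imaginary part v *)

Section Main.
Context {R : realType}.
Variable V : Z3 -> R.
Hypothesis V0 : forall k, 0 <= V k.
Hypothesis VN : forall k, V (- k) = V k.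
Hypothesis sVn : rsummable (fun k => V k * normZ3 R k).
Variables (kF : R) (kappa : R).
Hypothesis kF_ge1 : 1 <= kF.
Hypothesis kappa_gt0 : 0 < kappa.
Local Notation N := (Npart kF).
Local Notation FS := (@FSR R kF).
Variables u v : Tup N -> R.
Hypotheses (au : antisymR u) (av : antisymR v) (su : l2 u) (sv : l2 v).
Hypothesis sku : rsummable (fun p => kin R p * u p ^+ 2).
Hypothesis skv : rsummable (fun p => kin R p * v p ^+ 2).
Hypothesis uv1 : rsum (fun p => u p ^+ 2) + rsum (fun p => v p ^+ 2) = 1.
Variables a b : R.
Hypothesis Hu : forall p, HR V kF u p = a * u p - b * v p.
Hypothesis Hv : forall p, HR V kF v p = a * v p + b * u p.
Hypothesis Huv : ip u (HR V kF u) + ip v (HR V kF v) <=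
  ip FS (HR V kF FS) + kappa * kF.

Let sV := rsummable_V V0 sVn.
Let kF0 : 0 < kF := lt_le_trans ltr01 kF_ge1.

(** The expectation in u + i v of multiplication by [f]. *)
Let Q (f : Tup N -> R) := rsum (fun p => f p * u p ^+ 2) + rsum (fun p => f p * v p ^+ 2).
Let kin0 : R := \sum_(q <- BF kF) (sqnZ3 q)%:~R.
Let n := Q (NE kF (N := N)).
Let L k := 27 * normZ3 R k * kF ^+ 2.
Let Xk k := ip (dens k u) (dens k u) + ip (dens k v) (dens k v).
Let Fk k := ip (dens k FS) (dens k FS).
Let Yk k := ip (dens k (fun q => NE kF q * u q)) (dens k u)
  + ip (dens k (fun q => NE kF q * v q)) (dens k v).
(** At k = 0 the value of [Xk] is N^2, the same as for the Fermi sea; with this mode set to 0, the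
    bounds [XF] and [YF] hold for all k, the error [L] being 0 there too. *)
Let Xt (k : Z3) := if k == 0 then 0 else Xk k.
Let Z := rsum (fun k => V k * Xt k).
Let VS := rsum (fun k => V k * normZ3 R k).
Let g := @coupling R kF.

Let ip_sq (w : Tup N -> R) : ip w w = rsum (fun p => w p ^+ 2).
Proof. by apply: eq_rsum => p; rewrite expr2. Qed.

Let ip_ge0 (w : Tup N -> R) : 0 <= ip w w.
Proof. by rewrite ip_sq; apply: rsum_ge0 => p; exact: sqr_ge0. Qed.

Let sNu := NE_l2 (kF := kF) su.
Let sNv := NE_l2 (kF := kF) sv.

Let skN (w : Tup N -> R) : rsummable (fun p => kin R p * w p ^+ 2) ->
  rsummable (fun p => kin R p * ((NE kF p * w p) * w p)).
Proof.
move=> sw; apply: rsummable_le (rsummableZ N%:R sw) => p.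
have k0 : 0 <= kin R p by apply: sumr_ge0 => i _; rewrite ler0z sqnZ3_ge0.
have -> : kin R p * (NE kF p * w p * w p) = NE kF p * (kin R p * w p ^+ 2) by ring.
have k1 : 0 <= kin R p * w p ^+ 2 by rewrite mulr_ge0// sqr_ge0.
rewrite ger0_norm; last by apply: mulr_ge0 => //; exact: NE_ge0.
by apply: ler_wpM2r => //; exact: NE_le.
Qed.

Let nE : ip (fun q => NE kF q * u q) u + ip (fun q => NE kF q * v q) v = n.
Proof. by congr (_ + _); apply: eq_rsum => p; rewrite expr2 mulrA. Qed.

Let n_ge0 : 0 <= n.
Proof.
by apply: addr_ge0; apply: rsum_ge0 => p; rewrite mulr_ge0 ?NE_ge0 ?sqr_ge0.
Qed.

Let EFSE : ip FS (HR V kF FS) = kin0 + g * (dform V FS FS - N%:R * rsum V).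
Proof.
have sk : rsummable (fun p => kin R p * (FS p * FS p)).
  apply: rsummable_eq (rsummableZ kin0 (@l2_FSR R kF kF_ge1)) => p.
  by rewrite -expr2 kin_FSR.
rewrite (ip_HR V0 VN sVn kF (l2_FSR kF_ge1) (l2_FSR kF_ge1) sk).2 ip_sq rsum_FSR// mulr1.
congr (_ + _); rewrite (eq_rsum (g := fun p => kin0 * FS p ^+ 2)).
  by rewrite rsumZ ?rsum_FSR ?mulr1//; exact: l2_FSR.
by move=> p; rewrite -expr2 kin_FSR.
Qed.

Let energy (w : Tup N -> R) : l2 w -> rsummable (fun p => kin R p * w p ^+ 2) ->
  ip w (HR V kF w) = rsum (fun p => kin R p * w p ^+ 2) +
    g * (dform V w w - N%:R * ip w w * rsum V).
Proof.
move=> sw skw.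
have sk : rsummable (fun p => kin R p * (w p * w p)) by exact: skw.
exact: (ip_HR V0 VN sVn kF sw sw sk).2.
Qed.

Let energyN (w : Tup N -> R) : l2 w -> rsummable (fun p => kin R p * w p ^+ 2) ->
  ip (fun q => NE kF q * w q) (HR V kF w) =
    rsum (fun p => kin R p * (NE kF p * w p ^+ 2)) +
    g * (dform V (fun q => NE kF q * w q) w
         - N%:R * ip (fun q => NE kF q * w q) w * rsum V).
Proof.
move=> sw skw; rewrite (ip_HR V0 VN sVn kF (NE_l2 sw) sw (skN skw)).2.
by congr (_ + _); apply: eq_rsum => p; ring.
Qed.

Let QHkin : Q (@Hkin' R kF N) =
  rsum (fun p => kin R p * u p ^+ 2) + rsum (fun p => kin R p * v p ^+ 2) - kin0.
Proof.
have H (w : Tup N -> R) : l2 w -> rsummable (fun p => kin R p * w p ^+ 2) ->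
    rsum (fun p => Hkin' kF p * w p ^+ 2) = rsum (fun p => kin R p * w p ^+ 2)
      - kin0 * rsum (fun p => w p ^+ 2).
  move=> sw skw; rewrite -rsumZ// -rsumB//; last exact: rsummableZ.
  by apply: eq_rsum => p; rewrite /Hkin' mulrBl.
by rewrite /Q !H// -[in RHS](mulr1 kin0) -uv1; ring.
Qed.

Let QNHkin : Q (fun p => NE kF p * Hkin' kF p) =
  rsum (fun p => kin R p * (NE kF p * u p ^+ 2)) +
  rsum (fun p => kin R p * (NE kF p * v p ^+ 2)) - kin0 * n.
Proof.
have H (w : Tup N -> R) : l2 w -> rsummable (fun p => kin R p * w p ^+ 2) ->
    rsum (fun p => NE kF p * Hkin' kF p * w p ^+ 2) =
    rsum (fun p => kin R p * (NE kF p * w p ^+ 2))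
      - kin0 * rsum (fun p => NE kF p * w p ^+ 2).
  move=> sw skw; have sN := NE_summable (kF := kF) sw.
  have sk : rsummable (fun p => kin R p * (NE kF p * w p ^+ 2)).
    by apply: rsummable_eq (skN skw) => p; ring.
  rewrite -rsumZ// -rsumB//; last exact: rsummableZ.
  by apply: eq_rsum => p; rewrite /Hkin' /kin0; ring.
by rewrite /Q !H// /n /Q; ring.
Qed.

(** Here a + i b is the eigenvalue. The two equations contribute b u v with opposite signs, so only
    the real part a remains; the same cancellation, weighted by [NE], gives [anE]. *)
Let aE : ip u (HR V kF u) + ip v (HR V kF v) = a.
Proof.
have s1 := l2_mul su sv.
rewrite /ip (eq_rsum (g := fun p => a * u p ^+ 2 - b * (u p * v p))); last first.
  by move=> p; rewrite Hu; ring.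
rewrite [X in _ + X](eq_rsum (g := fun p => a * v p ^+ 2 + b * (u p * v p))); last first.
  by move=> p; rewrite Hv; ring.
rewrite rsumB ?rsumD; [|exact: rsummableZ..].
by rewrite !rsumZ// -[RHS]mulr1 -uv1; ring.
Qed.

Let anE : ip (fun q => NE kF q * u q) (HR V kF u)
  + ip (fun q => NE kF q * v q) (HR V kF v) = a * n.
Proof.
have s1 := l2_mul sNu sv.
have s2 := NE_summable (kF := kF) su; have s3 := NE_summable (kF := kF) sv.
rewrite /ip (eq_rsum (g := fun p => a * (NE kF p * u p ^+ 2)
    - b * (NE kF p * u p * v p))); last first.
  by move=> p; rewrite Hu; ring.
rewrite [X in _ + X](eq_rsum (g := fun p => a * (NE kF p * v p ^+ 2)
    + b * (NE kF p * u p * v p))); last first.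
  by move=> p; rewrite Hv; ring.
rewrite rsumB ?rsumD; [|exact: rsummableZ..].
by rewrite !rsumZ// /n /Q; ring.
Qed.

(** The self-interaction terms N times the sum of V agree for both states by normalization, so only
    kinetic and density terms remain in the difference. *)
Let E1 : Q (@Hkin' R kF N) + g * (dform V u u + dform V v v - dform V FS FS)
  <= kappa * kF.
Proof.
have := Huv; rewrite (energy su sku) (energy sv skv) EFSE QHkin.
have uv1' : ip u u + ip v v = 1 by rewrite !ip_sq.
have -> : ip u u = 1 - ip v v by lra.
by lra.
Qed.

(** The eigenvalue equation makes the pairing with N_E Psi equal to a n. Subtracting n times the
    Fermi sea energy, which also removes the self-interaction, leaves (a - E_FS) n with a - E_FS <=
    kappa kF. *)
Let E2 : Q (fun p => NE kF p * Hkin' kF p) +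
  g * (dform V (fun q => NE kF q * u q) u + dform V (fun q => NE kF q * v q) v
       - n * dform V FS FS) <= kappa * kF * n.
Proof.
have h1 : (a - ip FS (HR V kF FS)) * n <= kappa * kF * n.
  by apply: ler_wpM2r => //; rewrite -aE; move: Huv; lra.
apply: le_trans h1; rewrite mulrBl -anE (energyN su sku) (energyN sv skv) EFSE QNHkin.
have -> : ip (fun q => NE kF q * u q) u = n - ip (fun q => NE kF q * v q) v.
  by rewrite -nE addrK.
by lra.
Qed.

Let g_ge0 : 0 <= g.
Proof.
have pi0 : 0 <= 2 * pi :> R by rewrite mulr_ge0// pi_ge0.
by rewrite /g /coupling !mulr_ge0 ?invr_ge0 ?exprn_ge0// ltW.
Qed.

Let X0 : Xk 0 = N%:R ^+ 2.
Proof.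
have H (w : Tup N -> R) : l2 w -> ip (dens 0 w) (dens 0 w) =
    N%:R ^+ 2 * rsum (fun p => w p ^+ 2).
  move=> sw; rewrite -rsumZ// ip_sq; apply: eq_rsum => p.
  by rewrite dens0 exprMn.
by rewrite /Xk !H// -mulrDr uv1 mulr1.
Qed.

Let F0 : Fk 0 = N%:R ^+ 2.
Proof.
have sF := @l2_FSR R kF kF_ge1.
rewrite /Fk ip_sq (eq_rsum (g := fun p => N%:R ^+ 2 * FS p ^+ 2)) => [|p].
  by rewrite rsumZ// rsum_FSR// mulr1.
by rewrite dens0 exprMn.
Qed.

Let Y0 : Yk 0 = N%:R ^+ 2 * n.
Proof.
have H (w : Tup N -> R) : l2 w -> ip (dens 0 (fun q => NE kF q * w q)) (dens 0 w) =
    N%:R ^+ 2 * rsum (fun p => NE kF p * w p ^+ 2).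
  move=> sw; rewrite -rsumZ; last exact: NE_summable.
  by apply: eq_rsum => p; rewrite !dens0; ring.
by rewrite /Yk !H// -mulrDr.
Qed.

Let L0 : L 0 = 0. Proof. by rewrite /L normZ30 mulr0 mul0r. Qed.

Let L_ge0 k : 0 <= L k.
Proof. by rewrite /L !mulr_ge0 ?normZ3_ge0 ?exprn_ge0 ?ltW. Qed.

Let XF k : Xt k - L k <= Xk k - Fk k.
Proof.
rewrite /Xt; case: eqVneq => [->|k0]; first by rewrite L0 X0 F0 !subrr.
by rewrite lerB// ip_dens_FSR.
Qed.

(** Of the 3, two come from the commutator bound [ip_dens_NE] and one from n [Fk] <= n [L]. *)
Let YF k : - 2^-1 * Xt k - 3 * (n + 1) * L k <= Yk k - n * Fk k.
Proof.
rewrite /Xt; case: eqVneq => [->|k0].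
  by rewrite L0 Y0 F0 !mulr0 subrr mulrC subrr.
have yu := ip_dens_NE kF_ge1 k au su; have yv := ip_dens_NE kF_ge1 k av sv.
have Fb : n * Fk k <= n * L k by rewrite ler_wpM2l// ip_dens_FSR.
have H (w : Tup N -> R) : l2 w -> rsum (fun p => (NE kF p + 1) * w p ^+ 2) =
    rsum (fun p => NE kF p * w p ^+ 2) + rsum (fun p => w p ^+ 2).
  move=> sw; rewrite -rsumD//; last exact: NE_summable.
  by apply: eq_rsum => p; rewrite mulrDl mul1r.
move: yu yv; rewrite -/(L k) !H//.
have nn : rsum (fun p => NE kF p * u p ^+ 2) =
  n - rsum (fun p => NE kF p * v p ^+ 2) by rewrite /n /Q addrK.
have uu : rsum (fun p => u p ^+ 2) = 1 - rsum (fun p => v p ^+ 2).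
  by rewrite -uv1 addrK.
rewrite nn uu /Yk /Xk => yu yv; have := L_ge0 k; nra.
Qed.

Let Xk_ge0 k : 0 <= Xk k. Proof. exact: addr_ge0. Qed.

Let Xt_ge0 k : 0 <= Xt k. Proof. by rewrite /Xt; case: ifP. Qed.

Let sX : rsummable (fun k => V k * Xk k).
Proof.
apply: rsummable_eq (rsummableD (dform_summable V0 sVn su su)
  (dform_summable V0 sVn sv sv)) => k.
exact: mulrDr.
Qed.

Let sF : rsummable (fun k => V k * Fk k).
Proof. exact: (dform_summable V0 sVn (l2_FSR kF_ge1) (l2_FSR kF_ge1)). Qed.

Let sXt : rsummable (fun k => V k * Xt k).
Proof.
apply: rsummable_le sX => k; rewrite ger0_norm ?mulr_ge0//.
by rewrite ler_wpM2l// /Xt; case: ifP.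
Qed.

Let sL : rsummable (fun k => V k * L k).
Proof.
by apply: rsummable_eq (rsummableZ (27 * kF ^+ 2) sVn) => k; rewrite /L; ring.
Qed.

Let SL : rsum (fun k => V k * L k) = 27 * kF ^+ 2 * VS.
Proof. by rewrite -rsumZ//; apply: eq_rsum => k; rewrite /L; ring. Qed.

Let D1 : Z - 27 * kF ^+ 2 * VS <= dform V u u + dform V v v - dform V FS FS.
Proof.
rewrite /dform -rsumD; [|exact: dform_summable..].
rewrite -rsumB; [|by apply: rsummableD; exact: dform_summable|exact: sF].
rewrite -SL -rsumB//; apply: ler_rsum.
- exact: rsummableB.
- by apply: rsummableB => //; apply: rsummableD; exact: dform_summable.
- by move=> k; have := ler_wpM2l (V0 k) (XF k); rewrite /Xk /Fk; lra.
Qed.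

Let D2 : - 2^-1 * Z - 3 * (n + 1) * (27 * kF ^+ 2 * VS) <=
  dform V (fun q => NE kF q * u q) u + dform V (fun q => NE kF q * v q) v
  - n * dform V FS FS.
Proof.
rewrite /dform -rsumD; [|exact: dform_summable..].
rewrite -[n * _]rsumZ; last exact: sF.
rewrite -rsumB; [|by apply: rsummableD; exact: dform_summable|
  by apply: rsummableZ; exact: sF].
rewrite -SL /Z -![_ * rsum _]rsumZ// -rsumB; [|exact: rsummableZ..].
apply: ler_rsum.
- by apply: rsummableB; exact: rsummableZ.
- apply: rsummableB; last by apply: rsummableZ; exact: sF.
  by apply: rsummableD; exact: dform_summable.
- by move=> k; have := ler_wpM2l (V0 k) (YF k); rewrite /Yk /Fk; lra.
Qed.

Let n_le : n <= Q (@Hkin' R kF N).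
Proof.
have H (w : Tup N -> R) : antisymR w -> l2 w ->
    rsummable (fun p => kin R p * w p ^+ 2) ->
    rsum (fun p => NE kF p * w p ^+ 2) <= rsum (fun p => Hkin' kF p * w p ^+ 2).
  move=> aw sw skw; apply: ler_rsum; first exact: NE_summable.
    apply: rsummable_eq (rsummableB skw (rsummableZ kin0 sw)) => p.
    by rewrite /Hkin' mulrBl.
  move=> p; have [pinj|pinj] := pselect (injective p); last first.
    by rewrite (antisymR_noninj aw)// expr0n !mulr0.
  by rewrite ler_wpM2r ?sqr_ge0// NE_le_Hkin.
by apply: lerD; exact: H.
Qed.

Lemma real_bound : Q (@Hkin' R kF N) + kF^-1 * Q (fun p => NE kF p * Hkin' kF p) <=
  9 * (1 + 27 / 2 * (2 * pi) ^- 3 * VS) ^+ 2 * (kappa + 1) ^+ 2 * kF.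
Proof.
(* [B] is the total lune error in units of kF: the factor kF^2 of the lunes meets the kF^-1 of the
   coupling. *)
set B := 27 / 2 * (2 * pi) ^- 3 * VS.
have S0 : 0 <= VS by apply: rsum_ge0 => k; rewrite mulr_ge0// normZ3_ge0.
have pi3 : 0 <= (2 * pi : R) ^- 3 by rewrite invr_ge0 exprn_ge0// mulr_ge0// pi_ge0.
have B0 : 0 <= B by rewrite /B !mulr_ge0.
have gS : g * (27 * kF ^+ 2 * VS) = B * kF.
  rewrite /g /coupling /B; move: ((2 * pi) ^- 3) => c; field.
  by rewrite (gt_eqF kF0).
have Z0 : 0 <= Z by apply: rsum_ge0 => k; rewrite mulr_ge0.
have gZ0 : 0 <= g * Z by exact: mulr_ge0.
(* Keeping g Z on the left gives two bounds at once: for the kinetic energy, and for the density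
   term that [T2] leaves on its right-hand side. *)
have T1 : Q (@Hkin' R kF N) + g * Z <= (kappa + B) * kF.
  by have := ler_wpM2l g_ge0 D1; rewrite mulrBr gS; move: E1; lra.
have T2 : Q (fun p => NE kF p * Hkin' kF p) <=
    kappa * kF * n + 2^-1 * (g * Z) + 3 * (n + 1) * (B * kF).
  have := ler_wpM2l g_ge0 D2; rewrite mulrBr [g * (3 * _ * _)]mulrCA gS.
  by move: E2; lra.
have nT : n <= (kappa + B) * kF by move: n_le T1; lra.
have gZ : g * Z <= (kappa + B) * kF by move: n_le n_ge0 T1; lra.
(* n carries a coefficient of order kF and is itself of order kF; the product is quadratic in kappa
   and, after multiplication by kF^-1, of order kF. *)
have T2' : Q (fun p => NE kF p * Hkin' kF p) <=
    (kappa * kF + 3 * B * kF) * ((kappa + B) * kF) + 2^-1 * ((kappa + B) * kF)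
    + 3 * B * kF.
  have c0 : 0 <= kappa * kF + 3 * B * kF.
    by rewrite addr_ge0 ?mulr_ge0// ltW.
  by have := ler_wpM2l c0 nT; move: T2 gZ; lra.
have T3 : kF^-1 * Q (fun p => NE kF p * Hkin' kF p) <=
    (kappa + 3 * B) * ((kappa + B) * kF) + 2^-1 * (kappa + B) + 3 * B.
  rewrite mulrC ler_pdivrMr//; by move: T2'; lra.
have T1' : Q (@Hkin' R kF N) <= (kappa + B) * kF by move: T1 gZ0; lra.
have k0 := ltW kappa_gt0.
(* The remaining terms have no factor kF, and kF >= 1 lets them be absorbed into the others. *)
have h1 : 2^-1 * (kappa + B) + 3 * B <= (2^-1 * (kappa + B) + 3 * B) * kF.
  by rewrite ler_peMr// addr_ge0// mulr_ge0// addr_ge0.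
apply: (@le_trans _ _ (((kappa + B) + (kappa + 3 * B) * (kappa + B)
    + (2^-1 * (kappa + B) + 3 * B)) * kF)); first by move: T1' T3 h1; lra.
rewrite ler_wpM2r ?(ltW kF0)//.
(* Both sides are polynomials in kappa and B with nonnegative coefficients; the factor 9 dominates
   monomial by monomial, with room to spare. *)
have kB := mulr_ge0 k0 B0.
have := mulr_ge0 kB B0; have := mulr_ge0 k0 kB; have := mulr_ge0 kB kB.
have := sqr_ge0 kappa; have := sqr_ge0 B.
by nra.
Qed.

End Main.

(** * From complex wave functions to their real and imaginary parts *)

Lemma cabs_sqr (R : realType) (z : R[i]) :
  cabs z ^+ 2 = complex.Re z ^+ 2 + complex.Im z ^+ 2.
Proof. by rewrite /cabs sqr_sqrtr// addr_ge0 ?sqr_ge0. Qed.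

Lemma antisym_Re_Im (R : realType) N (psi : wf R N) : antisym psi ->
  antisymR (fun p => complex.Re (psi p)) /\ antisymR (fun p => complex.Im (psi p)).
Proof.
move=> ap; split=> s p; rewrite ap -signr_odd -[in RHS]signr_odd oddb;
by case: (odd_perm s); rewrite ?expr1 ?expr0 ?mulN1r ?mul1r//; case: (psi p).
Qed.

(** The domain condition weights by the square of the kinetic energy; the first power is controlled
    through t <= 1 + t^2. *)
Lemma kin_summable (R : realType) N (w : Tup N -> R) : l2 w ->
  rsummable (fun p => kin R p ^+ 2 * w p ^+ 2) -> rsummable (fun p => kin R p * w p ^+ 2).
Proof.
move=> sw sk; apply: rsummable_le (rsummableD sw sk) => p.
have k0 : 0 <= kin R p by apply: sumr_ge0 => i _; rewrite ler0z sqnZ3_ge0.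
rewrite ger0_norm; last by apply: mulr_ge0 => //; exact: sqr_ge0.
rewrite -[X in X + _]mul1r -mulrDl ler_wpM2r ?sqr_ge0//.
by have := sqr_ge0 (kin R p - 1); nra.
Qed.

Unset Implicit Arguments.

Theorem mainTheorem2 (R : realType) (Vhat : Z3 -> R)
  (Vhat_ge0 : forall k, 0 <= Vhat k)
  (Vhat_even : forall k, Vhat (oppZ3 k) = Vhat k)
  (Vhat_sum : summable [set: Z3] (fun k => (Vhat k * normZ3 R k)%:E)) :
  exists C : R, 0 < C /\
  forall (kF : R), 1 <= kF -> forall (kappa : R), 0 < kappa ->
  forall psi : wf R (Npart kF),
    antisym psi -> sq_summable psi -> in_dom_kin psi ->
    norm2 psi = 1 ->
    (exists E : R[i], forall p, HN Vhat kF psi p = E * psi p) ->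
    complex.Re (inner psi (HN Vhat kF psi)) <= EFS Vhat kF + kappa * kF ->
    rsum (fun p => (Hkin' kF p + kF^-1 * (NE kF p * Hkin' kF p)) * cabs (psi p) ^+ 2)
      <= C * (kappa + 1) ^+ 2 * kF.
Proof.
have sV := rsummable_V Vhat_ge0 Vhat_sum.
pose S := rsum (fun k => Vhat k * normZ3 R k).
have S0 : 0 <= S by apply: rsum_ge0 => k; rewrite mulr_ge0// normZ3_ge0.
have B0 : 0 <= 27 / 2 * (2 * pi : R) ^- 3 * S.
  by rewrite !mulr_ge0// invr_ge0 exprn_ge0// mulr_ge0// pi_ge0.
(* The constant of [real_bound], where [S] involves only V; the summand 1 keeps it positive even for
   V = 0. *)
exists (9 * (1 + 27 / 2 * (2 * pi) ^- 3 * S) ^+ 2); split.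
  by rewrite mulr_gt0// exprn_gt0// ltr_wpDr.
move=> kF kF_ge1 kappa kappa_gt0 psi apsi spsi kpsi psi1 [E HE] energy.
pose u p := complex.Re (psi p); pose v p := complex.Im (psi p).
have [au av] := antisym_Re_Im apsi.
have cE p : cabs (psi p) ^+ 2 = u p ^+ 2 + v p ^+ 2 by exact: cabs_sqr.
have su : l2 u.
  apply: rsummable_le spsi => p; rewrite cE ger0_norm ?sqr_ge0//.
  by rewrite lerDl sqr_ge0.
have sv : l2 v.
  apply: rsummable_le spsi => p; rewrite cE ger0_norm ?sqr_ge0//.
  by rewrite lerDr sqr_ge0.
have sku : rsummable (fun p => kin R p * u p ^+ 2).
  apply: kin_summable => //; apply: rsummable_le kpsi => p; rewrite cE.
  rewrite ger0_norm; last by apply: mulr_ge0; exact: sqr_ge0.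
  by rewrite ler_wpM2l ?sqr_ge0// lerDl sqr_ge0.
have skv : rsummable (fun p => kin R p * v p ^+ 2).
  apply: kin_summable => //; apply: rsummable_le kpsi => p; rewrite cE.
  rewrite ger0_norm; last by apply: mulr_ge0; exact: sqr_ge0.
  by rewrite ler_wpM2l ?sqr_ge0// lerDr sqr_ge0.
have uv1 : rsum (fun p => u p ^+ 2) + rsum (fun p => v p ^+ 2) = 1.
  by rewrite -rsumD// -psi1; apply: eq_rsum => p; rewrite cE.
(* The eigenvalue is given as a complex number, so its imaginary part couples the equations for u
   and v. *)
have Hu p : HR Vhat kF u p = complex.Re E * u p - complex.Im E * v p.
  rewrite -Re_HN HE /u /v.
  by move: E (psi p) {HE} => [a b] [x y] /=.
have Hv p : HR Vhat kF v p = complex.Re E * v p + complex.Im E * u p.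
  rewrite -Im_HN HE /u /v.
  by move: E (psi p) {HE Hu} => [a b] [x y] /=.
have Hpsi : complex.Re (inner psi (HN Vhat kF psi)) =
    ip u (HR Vhat kF u) + ip v (HR Vhat kF v).
  rewrite Re_inner /ip -rsumD.
  - by apply: eq_rsum => p; rewrite Re_HN Im_HN.
  - exact: (ip_HR Vhat_ge0 Vhat_even Vhat_sum kF su su sku).1.
  - exact: (ip_HR Vhat_ge0 Vhat_even Vhat_sum kF sv sv skv).1.
have HFS : EFS Vhat kF = ip (@FSR R kF) (HR Vhat kF (@FSR R kF)).
  rewrite /EFS Re_inner; apply: eq_rsum => p; rewrite psiFSE /= mul0r addr0 Re_HN.
  by congr (_ * HR _ _ _ _); apply/funext => q; rewrite psiFSE.
have H0 : ip u (HR Vhat kF u) + ip v (HR Vhat kF v) <=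
    ip (@FSR R kF) (HR Vhat kF (@FSR R kF)) + kappa * kF.
  by rewrite -Hpsi -HFS.
have := real_bound Vhat_ge0 Vhat_even Vhat_sum kF_ge1 kappa_gt0 au av su sv
  sku skv uv1 Hu Hv H0.
apply: le_trans; rewrite le_eqVlt; apply/orP; left; apply/eqP.
(* What remains is an equality between one sum over psi and four sums over u and v; splitting it
   requires each summand to be summable, for which [NE] is bounded by the number of particles. *)
have sH (w : Tup (Npart kF) -> R) : l2 w -> rsummable (fun p => kin R p * w p ^+ 2) ->
    rsummable (fun p => Hkin' kF p * w p ^+ 2).
  move=> sw skw.
  apply: rsummable_eq (rsummableB skw
    (rsummableZ (\sum_(q <- BF kF) (sqnZ3 q)%:~R) sw)) => p.
  by rewrite /Hkin' mulrBl.
have sNH (w : Tup (Npart kF) -> R) : rsummable (fun p => Hkin' kF p * w p ^+ 2) ->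
    rsummable (fun p => NE kF p * Hkin' kF p * w p ^+ 2).
  move=> sw; apply: rsummable_le (rsummableZ (Npart kF)%:R (rsummable_norm sw)) => p.
  rewrite -mulrA normrM ger0_norm ?NE_ge0//.
  by apply: ler_wpM2r => //; exact: NE_le.
have shu := sH _ su sku; have shv := sH _ sv skv.
have snu := sNH _ shu; have snv := sNH _ shv.
rewrite -rsumD// -rsumD// -rsumZ; last exact: rsummableD.
rewrite -rsumD; [|exact: rsummableD|by apply: rsummableZ; exact: rsummableD].
by apply: eq_rsum => p; rewrite cE; ring.
Qed.
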